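(* For all integers $k\ge 0$ one has $$\sum_{n=1}^\infty \sigma_1(n)\left[(2\pi n)^{k+1}\,{}_1F_1(-k-3;k+2;2\pi n)-\frac{(2\pi n)^{k+2}\,{}_1F_1(-k-2;k+3;2\pi n)}{k+2}\right]e^{-2\pi n}=0,$$ $$\sum_{n=1}^\infty \sigma_3(n)\left[(2\pi n)^{k+1}\,{}_1F_1(-k-2;k+5;2\pi n)-\frac{(2\pi n)^{k+2}\,{}_1F_1(-k-1;k+6;2\pi n)}{k+5}\right]e^{-2\pi n}=0,$$ $$\sum_{n=1}^\infty \sigma_5(n)\,(2\pi n)^{k+1}\,{}_1F_1(-k-1;k+7;2\pi n)\,e^{-2\pi n}=0.$$
   Context: $\sigma_a(n)=\sum_{d\mid n}d^a$ is the divisor function. ${}_1F_1(\alpha;\beta;z)=\sum_{j\ge0}\frac{(\alpha)_j}{(\beta)_j}\frac{z^j}{j!}$ is the confluent hypergeometric function, with $(x)_j=x(x+1)\cdots(x+j-1)$ and $(x)_0=1$; in all cases here the first parameter is a negative integer, so the series terminates and is a polynomial in $z$. *)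

(* Defs.v *)
From mathcomp Require Import all_boot.

(* Stated before the next imports, which rebind [^] on [nat]. *)
Definition divisor_sigma (a n : nat) : nat := (\sum_(d <- divisors n) d ^ a)%N.

From Stdlib Require Import Reals Factorial.
From Coquelicot Require Import Coquelicot.

Local Open Scope R_scope.

Fixpoint pochhammer (x : R) (j : nat) : R :=
  match j with
  | O => 1
  | S i => pochhammer x i * (x + INR i)
  end.

(* [Series] returns the sum of the series when it converges; this is always the
   case when [a] is a nonpositive integer and [b] > 0, since the terms then
   vanish for all large [j]. *)
Definition hyp1F1 (a b z : R) : R :=
  Series (fun j : nat =>
    pochhammer a j / pochhammer b j * (z ^ j / INR (fact j))).

(* [f 1 + f 2 + f 3 + ...] converges, with sum [s]; [f 0] is not used. *)
Definition is_series_from1 (f : nat -> R) (s : R) : Prop :=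
  is_series (fun m : nat => f (S m)) s.

(* Main.v *)
(** For [S_a t = sum_n sigma_a n * exp (- 2 pi n t)] with [a = 1, 3, 5] put
    [w = a + 1], [h = w / 2] and [f u = exp (h u) * S_a (exp u)]. Up to explicit
    elementary terms, the behaviour of Eisenstein series under [t -> 1/t] says
    that [f] is even ([w = 4]) or odd ([w = 2, 6]): these terms are multiples of
    [exp (h u)] and, for [w = 2] only, a constant. The differential operator
    [(D^2 - h^2)(D^2 - (h+1)^2)...(D^2 - (h+N-1)^2)] preserves parity, kills
    [exp (h u)], and turns [exp (h u - c t)], where [t = exp u] and
    [c = 2 pi n], into a multiple of
    [(c t)^N 1F1(-N; N+w; c t) exp (h u - c t)]. With [N = k + 1], the three
    identities are the vanishing at [u = 0] of the resulting function for
    [w = 6], of its first derivative for [w = 4] and of its second derivative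
    for [w = 2].

    The behaviour under [t -> 1/t] comes from the Lipschitz formula, which turns
    [S_a] into a double series over [m, k] of the real part of
    [(m t + i k)^(-w)]. *)

Require Import Defs.
From mathcomp Require all_boot.
From Stdlib Require Import Reals Factorial Lra Lia.
From Coquelicot Require Import Coquelicot.
Local Open Scope R_scope.

(** * Dominated convergence for series *)

(** The weight decides which derivative is used. An odd function vanishes at 0 and an even one has
    zero derivative there, which settles [w = 6] and [w = 4]. For [w = 2] the operator does not kill
    the constant, since each factor has a nonzero term of order zero: the constant spoils the value
    at 0, the first derivative is even and says nothing, and only the second derivative is odd
    without a remainder.

    The main obstacle is also at [w = 2]. There the double series is not absolutely convergent, and
    exchanging the two sums produces an extra term in [t]; this term is the constant just mentioned.
    For [w = 4, 6] a product majorant allows the exchange.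

    The partial fractions behind the Lipschitz formula are obtained from an identity over finitely
    many roots of unity by a limit, so real series with explicit majorants suffice throughout. *)

Lemma sum_n_succ (a : nat -> R) (n : nat) : sum_n a (S n) = sum_n a n + a (S n) :> R.
Proof. exact (sum_Sn a n). Qed.

Lemma sum_n_0 (a : nat -> R) : sum_n a 0 = a O :> R.
Proof. exact (sum_O a). Qed.

Lemma ex_series_abs_le (a b : nat -> R) :
  (forall n, Rabs (a n) <= b n) -> ex_series b -> ex_series a.
Proof. intros H Hb. apply (ex_series_le (V := R_CompleteNormedModule) a b); auto. Qed.

Lemma Series_abs_le (a b : nat -> R) :
  (forall n, Rabs (a n) <= b n) -> ex_series b -> Rabs (Series a) <= Series b.
Proof.
  intros H Hb.
  assert (E : ex_series (fun n => Rabs (a n))).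
  { apply (ex_series_abs_le _ b); auto. intros n. rewrite Rabs_Rabsolu. apply H. }
  eapply Rle_trans; [apply Series_Rabs, E|].
  apply Series_le; auto. intros n. split; [apply Rabs_pos|apply H].
Qed.

Lemma Series_split (a : nat -> R) (N : nat) :
  ex_series a -> Series a = sum_n a N + Series (fun k => a (S N + k)%nat).
Proof.
  intros Ha. rewrite (Series_incr_n a (S N)); [|lia|exact Ha].
  rewrite sum_n_Reals. reflexivity.
Qed.

Lemma ex_series_shift (a : nat -> R) (N : nat) :
  ex_series a -> ex_series (fun k => a (N + k)%nat).
Proof. intros Ha. apply (ex_series_incr_n (V := R_NormedModule) a N), Ha. Qed.

Lemma is_lim_seq_sum_n (a : nat -> R) :
  ex_series a -> is_lim_seq (sum_n a) (Series a).
Proof. intros Ha. exact (Series_correct a Ha). Qed.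

Lemma Series_tail_small (a : nat -> R) (eps : posreal) :
  ex_series a -> exists N, Rabs (Series (fun k => a (S N + k)%nat)) < eps.
Proof.
  intros Ha. pose proof (is_lim_seq_sum_n a Ha) as H.
  apply is_lim_seq_spec in H. destruct (H eps) as [N HN]. exists N.
  specialize (HN N (le_n N)). rewrite (Series_split a N Ha) in HN.
  rewrite <- Rabs_Ropp. eapply Rle_lt_trans; [|exact HN]. right. f_equal. ring.
Qed.

Lemma filterlim_sum_n {T : Type} {F : (T -> Prop) -> Prop} {FF : Filter F}
  (f : T -> nat -> R) (g : nat -> R) (N : nat) :
  (forall k, filterlim (fun s => f s k) F (locally (g k))) ->
  filterlim (fun s => sum_n (f s) N) F (locally (sum_n g N)).
Proof.
  intros H. induction N as [|N IH].
  - rewrite sum_O. apply (filterlim_ext (fun s => f s O)).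
    + intros s. now rewrite sum_O.
    + apply H.
  - rewrite sum_n_succ. apply (filterlim_ext (fun s => plus (sum_n (f s) N) (f s (S N)))).
    + intros s. now rewrite sum_n_succ.
    + eapply filterlim_comp_2; [exact IH|apply H|].
      apply (filterlim_plus (V := R_NormedModule)).
Qed.

(** Tannery's theorem: the majorant makes all tails beyond one [N] smaller than [eps / 3], whatever
    [s] is, and finitely many terms remain. The filter is arbitrary because the lemma serves both
    sequences and difference quotients. *)
Lemma Series_dominated_lim {T : Type} {F : (T -> Prop) -> Prop} {FF : Filter F}
  (f : T -> nat -> R) (g A : nat -> R) :
  ex_series A ->
  (forall k, Rabs (g k) <= A k) ->
  F (fun s => forall k, Rabs (f s k) <= A k) ->
  (forall k, filterlim (fun s => f s k) F (locally (g k))) ->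
  filterlim (fun s => Series (f s)) F (locally (Series g)).
Proof.
  intros HA Hg Hf Hl. apply filterlim_locally. intros eps.
  assert (He : 0 < eps / 3) by (destruct eps as [e p]; simpl; lra).
  destruct (Series_tail_small A (mkposreal _ He) HA) as [N HN]. simpl in HN.
  pose proof (filterlim_sum_n f g N Hl) as HS.
  pose proof (proj1 (filterlim_locally _ _) HS (mkposreal _ He)) as HE.
  generalize (filter_and _ _ Hf HE). apply filter_imp. intros s [H1 H2].
  change (Rabs (sum_n (f s) N - sum_n g N) < eps / 3) in H2.
  change (Rabs (Series (f s) - Series g) < eps).
  rewrite (Series_split (f s) N) by (apply (ex_series_abs_le _ A); auto).
  rewrite (Series_split g N) by (apply (ex_series_abs_le _ A); auto).
  assert (B : forall h : nat -> R, (forall k, Rabs (h k) <= A k) ->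
    Rabs (Series (fun k => h (S N + k)%nat)) < eps / 3).
  { intros h Hh. eapply Rle_lt_trans; [|exact HN].
    eapply Rle_trans; [|apply Rle_abs].
    apply Series_abs_le; [intros n; apply Hh|exact (ex_series_shift A (S N) HA)]. }
  pose proof (B _ H1) as B1. pose proof (B _ Hg) as B2.
  apply Rabs_def2 in H2. apply Rabs_def2 in B1. apply Rabs_def2 in B2.
  apply Rabs_def1; lra.
Qed.

Lemma Series_sum_n_swap (x : nat -> nat -> R) (M : nat) :
  (forall m, ex_series (x m)) ->
  ex_series (fun k => sum_n (fun m => x m k) M) /\
  Series (fun k => sum_n (fun m => x m k) M) = sum_n (fun m => Series (x m)) M.
Proof.
  intros H. induction M as [|M [E IH]].
  - split.
    + apply (ex_series_ext (x O)); [intros k; now rewrite sum_O|apply H].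
    + rewrite sum_O. apply Series_ext. intros k. now rewrite sum_O.
  - split.
    + apply (ex_series_ext (fun k => plus (sum_n (fun m => x m k) M) (x (S M) k))).
      * intros k. now rewrite sum_n_succ.
      * apply (ex_series_plus (V := R_NormedModule)); auto.
    + rewrite sum_n_succ, <- IH, <- Series_plus; auto.
      apply Series_ext. intros k. now rewrite sum_n_succ.
Qed.

Lemma sum_n_le_Series (a : nat -> R) (N : nat) :
  (forall n, 0 <= a n) -> ex_series a -> sum_n a N <= Series a.
Proof.
  intros H Ha. rewrite (Series_split a N Ha).
  assert (0 <= Series (fun k => a (S N + k)%nat)); [|lra].
  replace 0 with (Series (fun _ : nat => 0)).
  - apply Series_le; [intros n; split; [lra|apply H]|exact (ex_series_shift a (S N) Ha)].
  - apply is_series_unique. apply (filterlim_ext (fun _ => 0)).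
    + intros n. rewrite sum_n_const. ring.
    + apply filterlim_const.
Qed.

Lemma Rabs_sum_n_le (a : nat -> R) (N : nat) :
  Rabs (sum_n a N) <= sum_n (fun n => Rabs (a n)) N.
Proof.
  induction N as [|N IH]; [rewrite !sum_O; lra|].
  rewrite !sum_n_succ. eapply Rle_trans; [apply Rabs_triang|lra].
Qed.

Section DoubleSeries.

Variables (x : nat -> nat -> R) (A B : nat -> R).
Hypothesis HA : ex_series A.
Hypothesis HB : ex_series B.
Hypothesis Hx : forall m k, Rabs (x m k) <= A m * B k.

Lemma ex_series_row (m : nat) : ex_series (x m).
Proof.
  apply (ex_series_abs_le _ (fun k => A m * B k)); [apply Hx|].
  apply (ex_series_scal (V := R_NormedModule) (A m) B), HB.
Qed.

Lemma ex_series_col (k : nat) : ex_series (fun m => x m k).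
Proof.
  apply (ex_series_abs_le _ (fun m => B k * A m)).
  - intros m. rewrite Rmult_comm. apply Hx.
  - apply (ex_series_scal (V := R_NormedModule) (B k) A), HA.
Qed.

Lemma ex_series_Series_row : ex_series (fun m => Series (x m)).
Proof.
  apply (ex_series_abs_le _ (fun m => Series B * A m)).
  - intros m. rewrite Rmult_comm, <- Series_scal_l. apply Series_abs_le; [apply Hx|].
    apply (ex_series_scal (V := R_NormedModule) (A m) B), HB.
  - apply (ex_series_scal (V := R_NormedModule) (Series B) A), HA.
Qed.

(** Fubini with a product majorant: the exchange is elementary for finitely many rows, and dominated
    convergence with majorant [Series A * B k] lets their number grow. *)
Lemma Series_swap :
  Series (fun m => Series (x m)) = Series (fun k => Series (fun m => x m k)).
Proof.
  apply is_series_unique.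
  assert (P : forall m k, 0 <= A m * B k).
  { intros m k. eapply Rle_trans; [apply Rabs_pos|apply Hx]. }
  assert (EA : forall k, ex_series (fun m => A m * B k)).
  { intros k. apply (ex_series_ext (fun m => scal (B k) (A m))).
    - intros m. apply Rmult_comm.
    - apply (ex_series_scal (V := R_NormedModule)), HA. }
  apply (filterlim_ext (fun M => Series (fun k => sum_n (fun m => x m k) M))).
  { intros M. apply Series_sum_n_swap. intros m. apply ex_series_row. }
  apply (Series_dominated_lim _ _ (fun k => Series A * B k)).
  - apply (ex_series_scal (V := R_NormedModule) (Series A) B), HB.
  - intros k. rewrite <- Series_scal_r. apply Series_abs_le; auto.
  - apply filter_forall. intros M k. rewrite <- Series_scal_r.
    eapply Rle_trans; [apply Rabs_sum_n_le|].
    eapply Rle_trans; [|apply sum_n_le_Series; auto].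
    rewrite !sum_n_Reals. apply sum_Rle. intros; apply Hx.
  - intros k. apply (is_lim_seq_sum_n (fun m => x m k)), ex_series_col.
Qed.

End DoubleSeries.

Lemma is_derive_quotient (f : R -> R) (x l : R) :
  is_derive f x l <-> filterlim (fun h => (f (x + h) - f x) / h) (locally' 0) (locally l).
Proof.
  rewrite is_derive_Reals, filterlim_locally. split.
  - intros H eps. destruct (H eps (cond_pos eps)) as [d Hd].
    exists d. intros h Bh Hh. apply Hd; auto.
    change (Rabs (h - 0) < d) in Bh. now rewrite Rminus_0_r in Bh.
  - intros H eps He. destruct (H (mkposreal eps He)) as [d Hd].
    exists d. intros h Hh Bh. apply Hd; auto.
    change (Rabs (h - 0) < d). now rewrite Rminus_0_r.
Qed.

(** Dominated convergence for difference quotients: by the mean value theorem each one is a value of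
    [f' k] at distance less than [r] from [x], hence bounded by [M k]. *)
Lemma is_derive_Series (f f' : nat -> R -> R) (M : nat -> R) (x r : R) :
  0 < r ->
  (forall k y, Rabs (y - x) < r -> is_derive (f k) y (f' k y)) ->
  (forall k y, Rabs (y - x) < r -> Rabs (f' k y) <= M k) ->
  ex_series M ->
  (forall y, Rabs (y - x) < r -> ex_series (fun k => f k y)) ->
  is_derive (fun y => Series (fun k => f k y)) x (Series (fun k => f' k x)).
Proof.
  intros Hr Hd Hb HM Hs. apply is_derive_quotient.
  assert (X0 : Rabs (x - x) < r) by (rewrite Rminus_diag, Rabs_R0; exact Hr).
  assert (Near : locally' 0 (fun h : R => h <> 0 /\ Rabs (x + h - x) < r)).
  { exists (mkposreal r Hr). intros h Bh Hh. split; auto.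
    change (Rabs (h - 0) < r) in Bh. now replace (x + h - x) with (h - 0) by ring. }
  apply (filterlim_ext_loc (fun h => Series (fun k => (f k (x + h) - f k x) / h))).
  { generalize Near. apply filter_imp. intros h [H0 H1].
    unfold Rdiv. rewrite Series_scal_r, Series_minus; auto. }
  apply (Series_dominated_lim _ _ M); auto.
  - generalize Near. apply filter_imp. intros h [H0 H1] k.
    assert (I : forall y, Rmin x (x + h) <= y <= Rmax x (x + h) -> Rabs (y - x) < r).
    { intros y [Y1 Y2]. eapply Rle_lt_trans; [|exact H1].
      revert Y1 Y2. unfold Rmin, Rmax. destruct (Rle_dec x (x + h)) as [L|L]; intros.
      - rewrite !Rabs_pos_eq; lra.
      - rewrite !Rabs_left1; lra. }
    destruct (MVT_gen (f k) x (x + h) (f' k)) as [c [C1 C2]].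
    + intros y Hy. apply Hd, I. lra.
    + intros y Hy. apply continuity_pt_filterlim.
      apply (ex_derive_continuous (V := R_NormedModule)). exists (f' k y). apply Hd, I, Hy.
    + rewrite C2. replace (f' k c * (x + h - x) / h) with (f' k c) by (field; auto).
      apply Hb, I, C1.
  - intros k. apply is_derive_quotient, Hd, X0.
Qed.

(** * Partial fractions of the hyperbolic cotangent *)

(** Real part of [(1 - q^(N+1)) (1 - conj q)] for [q = r exp (i th)]; the factor on the left is
    [|1 - q|^2]. *)
Lemma geometric_cos_sum (r th : R) (N : nat) :
  sum_n (fun d => r ^ d * cos (INR d * th)) N * (1 - 2 * r * cos th + r ^ 2)
  = 1 - r * cos th - r ^ S N * cos (INR (S N) * th) + r ^ S (S N) * cos (INR N * th).
Proof.
  induction N as [|N IH].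
  - rewrite sum_n_0. change (INR 0) with 0. change (INR 1) with 1.
    rewrite Rmult_0_l, !Rmult_1_l, cos_0. ring.
  - rewrite sum_n_succ, Rmult_plus_distr_r, IH.
    replace (INR (S (S N)) * th) with (INR (S N) * th + th) by (rewrite (S_INR (S N)); ring).
    replace (INR N * th) with (INR (S N) * th - th) by (rewrite (S_INR N); ring).
    rewrite cos_plus, cos_minus. simpl pow. ring.
Qed.

(** The term [j = 0] enters the doubled sum as 2, so the bracket is the sum of [exp (i j th)] over
    [-M <= j <= M]. *)
Lemma dirichlet_kernel (th : R) (M : nat) :
  sin (th / 2) * (1 + 2 * sum_n (fun j => cos (INR j * th)) M - 2)
  = sin ((INR M + / 2) * th).
Proof.
  induction M as [|M IH].
  - rewrite sum_n_0. change (INR 0) with 0. rewrite Rmult_0_l, cos_0.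
    replace ((0 + / 2) * th) with (th / 2) by field. ring.
  - rewrite sum_n_succ, S_INR.
    replace ((INR M + 1 + / 2) * th) with ((INR M + 1) * th + th / 2) by field.
    replace ((INR M + / 2) * th) with ((INR M + 1) * th - th / 2) in IH by field.
    rewrite sin_plus. rewrite sin_minus in IH. lra.
Qed.

Lemma sin_INR_PI (d : nat) : sin (INR d * PI) = 0.
Proof. apply sin_eq_0_1. exists (Z.of_nat d). now rewrite INR_IZR_INZ. Qed.

(** The order [2 M + 1] is odd, so every root of unity except 1 pairs with its conjugate and
    [j <= M] suffices. The Dirichlet kernel has numerator [sin (d PI) = 0], and
    [0 < th / 2 < PI]. *)
Lemma cos_sum_roots_of_unity (M d : nat) :
  (0 < d < 2 * M + 1)%nat ->
  1 + 2 * sum_n (fun j => cos (INR j * (2 * PI * INR d / INR (2 * M + 1)))) M - 2 = 0.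
Proof.
  intros [D0 D1]. pose proof PI_RGT_0 as HP.
  apply lt_INR in D0. apply lt_INR in D1. simpl (INR 0) in D0.
  assert (HN : INR (2 * M + 1) = 2 * INR M + 1).
  { rewrite plus_INR, mult_INR. reflexivity. }
  rewrite HN in *. pose proof (pos_INR M) as HM.
  set (th := 2 * PI * INR d / (2 * INR M + 1)).
  pose proof (dirichlet_kernel th M) as H.
  replace ((INR M + / 2) * th) with (INR d * PI) in H by (unfold th; field; lra).
  rewrite sin_INR_PI in H. apply Rmult_integral in H. destruct H as [H|H]; [|exact H].
  exfalso. assert (0 < sin (th / 2)); [|lra].
  assert (E : th / 2 * (2 * INR M + 1) = PI * INR d) by (unfold th; field; lra).
  apply sin_gt_0; nra.
Qed.

Lemma poisson_kernel_denom_pos (r th : R) :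
  0 < r < 1 -> 0 < 1 - 2 * r * cos th + r ^ 2.
Proof. intros H. pose proof (COS_bound th). nra. Qed.

Definition poisson_kernel (r th : R) : R := (1 - r ^ 2) / (1 - 2 * r * cos th + r ^ 2).

(** The kernel is [2 sum_(d >= 0) r^d cos (d th) - 1]. Here the cosine has period [2 M + 1] in [d],
    so the series folds onto one period, with a geometric factor. *)
Lemma poisson_kernel_root_of_unity (r : R) (M j : nat) :
  0 < r < 1 ->
  poisson_kernel r (2 * PI * INR j / INR (2 * M + 1)) =
  2 / (1 - r ^ (2 * M + 1)) *
    sum_n (fun d => r ^ d * cos (INR j * (2 * PI * INR d / INR (2 * M + 1)))) (2 * M) - 1.
Proof.
  intros Hr. set (th := 2 * PI * INR j / INR (2 * M + 1)).
  pose proof (poisson_kernel_denom_pos r th Hr) as HD.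
  pose proof (geometric_cos_sum r th (2 * M)) as H.
  replace (S (2 * M)) with (2 * M + 1)%nat in H by lia.
  assert (NZ : INR (2 * M + 1) <> 0) by (apply not_0_INR; lia).
  assert (E : INR (2 * M + 1) * th = 2 * INR j * PI) by (unfold th; field; auto).
  assert (C1 : cos (INR (2 * M + 1) * th) = 1).
  { rewrite E, <- (Rplus_0_l (2 * INR j * PI)), cos_period. apply cos_0. }
  assert (C2 : cos (INR (2 * M) * th) = cos th).
  { replace (INR (2 * M) * th) with (- th + 2 * INR j * PI).
    - now rewrite cos_period, cos_neg.
    - rewrite <- E, plus_INR. simpl (INR 1). ring. }
  rewrite C1, C2 in H.
  rewrite (sum_n_ext _ (fun d => r ^ d * cos (INR d * th))).
  2:{ intros d. do 2 f_equal. unfold th. field. auto. }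
  unfold poisson_kernel.
  assert (P1 : r ^ (2 * M + 1) < 1) by (apply pow_lt_1_compat; [lra|lia]).
  set (S0 := sum_n _ _) in *. set (q := r ^ (2 * M + 1)) in *.
  replace (r ^ S (2 * M + 1)) with (r * q) in H by reflexivity.
  apply (Rmult_eq_reg_r (1 - 2 * r * cos th + r ^ 2)); [|lra].
  apply (Rmult_eq_reg_r (1 - q)); [|lra].
  replace ((2 / (1 - q) * S0 - 1) * (1 - 2 * r * cos th + r ^ 2) * (1 - q))
    with (2 * (S0 * (1 - 2 * r * cos th + r ^ 2)) - (1 - 2 * r * cos th + r ^ 2) * (1 - q))
    by (field; lra).
  rewrite H. field. lra.
Qed.

Lemma sum_n_affine (c : R) (v : nat -> R) (M : nat) :
  sum_n (fun j => c * v j - 1) M = c * sum_n v M - (INR M + 1) :> R.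
Proof.
  induction M as [|M IH].
  - rewrite !sum_n_0. simpl. ring.
  - rewrite !sum_n_succ, IH, S_INR. ring.
Qed.

(** The left side runs over all roots of unity of order [2 M + 1], with 1 counted once.
    Orthogonality leaves the frequencies divisible by [2 M + 1], a geometric series in
    [r ^ (2 M + 1)]. *)
Lemma poisson_kernel_sum (r : R) (M : nat) :
  0 < r < 1 ->
  2 * sum_n (fun j => poisson_kernel r (2 * PI * INR j / INR (2 * M + 1))) M
    - poisson_kernel r 0
  = INR (2 * M + 1) * (1 + r ^ (2 * M + 1)) / (1 - r ^ (2 * M + 1)).
Proof.
  intros Hr.
  assert (P1 : r ^ (2 * M + 1) < 1) by (apply pow_lt_1_compat; [lra|lia]).
  set (q := r ^ (2 * M + 1)) in *. set (N := INR (2 * M + 1)).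
  set (W := fun d => sum_n (fun j => cos (INR j * (2 * PI * INR d / N))) M).
  assert (E1 : sum_n (fun j => poisson_kernel r (2 * PI * INR j / N)) M =
    2 / (1 - q) * sum_n (fun d => r ^ d * W d) (2 * M) - (INR M + 1)).
  { rewrite (sum_n_ext _ _ _ (fun j => poisson_kernel_root_of_unity r M j Hr)).
    fold q N. unfold W. clear W.
    rewrite (sum_n_ext (fun d => r ^ d * sum_n (fun j => cos (INR j * (2 * PI * INR d / N))) M)
      (fun d => sum_n (fun j => r ^ d * cos (INR j * (2 * PI * INR d / N))) M)).
    2:{ intros d. symmetry. apply (sum_n_mult_l (K := R_Ring)). }
    rewrite sum_n_switch.
    exact (sum_n_affine _ (fun j =>
      sum_n (fun d => r ^ d * cos (INR j * (2 * PI * INR d / N))) (2 * M)) M). }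
  rewrite E1.
  assert (K0 : poisson_kernel r 0 =
    2 / (1 - q) * sum_n (fun d => r ^ d) (2 * M) - 1).
  { pose proof (poisson_kernel_root_of_unity r M 0 Hr) as H.
    change (INR 0) with 0 in H. unfold Rdiv at 1 in H. rewrite Rmult_0_r, Rmult_0_l in H.
    rewrite H. fold q. do 2 f_equal. apply sum_n_ext. intros d.
    rewrite Rmult_0_l, cos_0. apply Rmult_1_r. }
  rewrite K0.
  (* Only [d = 0] contributes: [2 * W 0 - 1 = N], whereas [W d = / 2] for the other [d]. *)
  assert (E2 : 2 * sum_n (fun d => r ^ d * W d) (2 * M) - sum_n (fun d => r ^ d) (2 * M) = N).
  { assert (G : forall L, (L <= 2 * M)%nat ->
      2 * sum_n (fun d => r ^ d * W d) L - sum_n (fun d => r ^ d) L = N); [|apply G; lia].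
    induction L as [|L IH]; intros HL.
    - rewrite !sum_n_0. unfold W.
      rewrite (sum_n_ext _ (fun _ => 1)).
      2:{ intros j. change (INR 0) with 0. unfold Rdiv. rewrite Rmult_0_r, Rmult_0_l, Rmult_0_r.
          apply cos_0. }
      rewrite sum_n_const. unfold N. rewrite plus_INR, mult_INR, S_INR. simpl. ring.
    - rewrite !sum_n_succ. pose proof (cos_sum_roots_of_unity M (S L)) as H.
      specialize (H ltac:(lia)). fold N in H. fold (W (S L)) in H.
      specialize (IH ltac:(lia)).
      replace (W (S L)) with (/ 2) by lra. lra. }
  assert (HN : N = 2 * INR M + 1) by (unfold N; rewrite plus_INR, mult_INR; reflexivity).
  replace (N * (1 + q) / (1 - q)) with (2 / (1 - q) * N - N) by (field; lra).
  rewrite <- E2 at 1. rewrite HN. field. lra.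
Qed.

Lemma is_series_finite (a : nat -> R) (N : nat) :
  (forall n, (N < n)%nat -> a n = 0) -> is_series a (sum_n a N : R).
Proof.
  intros H. apply (filterlim_ext_loc (fun _ => sum_n a N)); [|apply filterlim_const].
  exists N. intros n Hn. induction Hn as [|n Hn IH]; auto.
  etransitivity; [exact IH|]. symmetry. etransitivity; [apply sum_n_succ|].
  rewrite H by lia. apply Rplus_0_r.
Qed.

Lemma ex_series_scal_R (c : R) (a : nat -> R) :
  ex_series a -> ex_series (fun n => c * a n).
Proof. intros H. apply (ex_series_scal (V := R_NormedModule) c a), H. Qed.

Lemma ex_series_inv_sq : ex_series (fun n => / INR (S n) ^ 2).
Proof.
  apply (ex_series_abs_le _ (fun n => 2 * (/ INR (S n) - / INR (S (S n))))).
  - intros n. rewrite (S_INR (S n)).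
    assert (H : 1 <= INR (S n)) by (rewrite S_INR; pose proof (pos_INR n); lra).
    set (y := INR (S n)) in *.
    rewrite Rabs_pos_eq by (apply Rlt_le, Rinv_0_lt_compat, pow_lt; lra).
    replace (/ y ^ 2) with ((y + 1) / (y ^ 2 * (y + 1))) by (field; lra).
    replace (2 * (/ y - / (y + 1))) with (2 * y / (y ^ 2 * (y + 1))) by (field; lra).
    apply Rmult_le_compat_r; [|lra].
    apply Rlt_le, Rinv_0_lt_compat, Rmult_lt_0_compat; [apply pow_lt|]; lra.
  - assert (T : forall n, sum_n (fun n => / INR (S n) - / INR (S (S n))) n
      = 1 - / INR (S (S n)) :> R).
    { induction n as [|n IH]; [rewrite sum_n_0; simpl; field|].
      rewrite sum_n_succ, IH. ring. }
    apply ex_series_scal_R. exists 1.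
    apply (filterlim_ext (fun n => 1 - / INR (S (S n)))).
    + intros n. symmetry. apply T.
    + assert (L : is_lim_seq (fun n => 1 - / INR (S (S n))) (1 - 0)).
      { apply is_lim_seq_minus'; [apply is_lim_seq_const|].
        apply (is_lim_seq_incr_1 (fun n => / INR (S n))), (is_lim_seq_incr_1 (fun n => / INR n)).
        apply (is_lim_seq_inv INR p_infty); [apply is_lim_seq_INR|easy]. }
      rewrite Rminus_0_r in L. exact L.
Qed.

Lemma one_add_le_exp (x : R) : 1 + x <= exp x.
Proof.
  destruct (Req_dec x 0) as [->|H]; [rewrite exp_0; lra|].
  apply Rlt_le, exp_ineq1, H.
Qed.

Lemma pow_exp (x : R) (n : nat) : exp x ^ n = exp (INR n * x).
Proof.
  induction n as [|n IH].
  - simpl. now rewrite Rmult_0_l, exp_0.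
  - rewrite S_INR. simpl pow. rewrite IH, <- exp_plus. f_equal. ring.
Qed.

(** From [sin y >= y - y^3 / 6] and [y^2 <= 4]. *)
Lemma sin_ge_third (y : R) : 0 <= y <= PI / 2 -> y / 3 <= sin y.
Proof.
  intros [H0 H1]. pose proof PI_4 as HP.
  destruct (pre_sin_bound y 0) as [L _]; [lra|lra|].
  eapply Rle_trans; [|exact L]. unfold sin_approx, sin_term. simpl.
  assert (y * y <= 4) by nra. nra.
Qed.

Lemma is_lim_seq_poisson_quotient (a b c : nat -> R) (la lb lc : R) :
  is_lim_seq a la -> is_lim_seq b lb -> is_lim_seq c lc ->
  la ^ 2 + 4 * lc * lb ^ 2 <> 0 ->
  is_lim_seq (fun n => a n * (1 + c n) / (a n ^ 2 + 4 * c n * b n ^ 2))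
    (la * (1 + lc) / (la ^ 2 + 4 * lc * lb ^ 2)).
Proof.
  intros La Lb Lc H. simpl pow in *. apply is_lim_seq_div'; [| |exact H].
  - apply is_lim_seq_mult'; [exact La|].
    apply is_lim_seq_plus'; [apply is_lim_seq_const|exact Lc].
  - apply is_lim_seq_plus'; repeat apply is_lim_seq_mult'; auto; apply is_lim_seq_const.
Qed.

(* The Poisson kernel summed over the [N]-th roots of unity is elementary; with
   [r = exp (- 2 pi x / N)] its terms, divided by [N], tend to those of the
   partial fraction expansion. *)
Section PartialFractions.

Variable x : R.
Hypothesis Hx : 0 < x.

Let N (M : nat) : R := INR (2 * M + 1).
Let w (M : nat) : R := 2 * PI * x / N M.
Let r (M : nat) : R := exp (- w M).
(** Extended by 0 beyond [M], so that the finite sums become series on which dominated convergence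
    acts. *)
Let f (M j : nat) : R :=
  if Nat.leb j M then poisson_kernel (r M) (2 * PI * INR j / N M) / N M else 0.

Let N_eq M : N M = 2 * INR M + 1.
Proof. unfold N. rewrite plus_INR, mult_INR. reflexivity. Qed.

Let N_pos M : 1 <= N M.
Proof. rewrite N_eq. pose proof (pos_INR M). lra. Qed.

Let w_pos M : 0 < w M.
Proof.
  unfold w. pose proof (N_pos M). pose proof PI_RGT_0.
  apply Rdiv_lt_0_compat; [apply Rmult_lt_0_compat|]; lra.
Qed.

Let r_bound M : 0 < r M < 1.
Proof.
  split; [apply exp_pos|]. unfold r. rewrite <- exp_0. apply exp_increasing.
  pose proof (w_pos M). lra.
Qed.

(** The half-angle form isolates [N (1 - r)] and [N sin (PI j / N)], which tend to [2 PI x] and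
    [PI j]. *)
Let f_eq M j : (j <= M)%nat ->
  f M j = N M * (1 - r M) * (1 + r M) /
    ((N M * (1 - r M)) ^ 2 + 4 * r M * (N M * sin (PI * INR j / N M)) ^ 2).
Proof.
  intros H. unfold f. apply Nat.leb_le in H. rewrite H. unfold poisson_kernel.
  pose proof (N_pos M) as HN. pose proof (r_bound M) as Hr.
  replace (2 * PI * INR j / N M) with (2 * (PI * INR j / N M)) by (field; lra).
  rewrite cos_2a_sin. set (s := sin _).
  assert (HD : 0 < (1 - r M) ^ 2 + 4 * r M * s ^ 2) by nra.
  replace (1 - 2 * r M * (1 - 2 * s * s) + r M ^ 2)
    with ((1 - r M) ^ 2 + 4 * r M * s ^ 2) by ring.
  replace ((N M * (1 - r M)) ^ 2 + 4 * r M * (N M * s) ^ 2)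
    with (N M ^ 2 * ((1 - r M) ^ 2 + 4 * r M * s ^ 2)) by ring.
  set (D := (1 - r M) ^ 2 + 4 * r M * s ^ 2) in *. field. lra.
Qed.

Let lim_w : is_lim_seq w 0.
Proof.
  apply (is_lim_seq_ext (fun M => 2 * PI * x * / N M)); [reflexivity|].
  replace (Finite 0) with (Rbar_mult (2 * PI * x) 0) by (simpl; f_equal; ring).
  apply is_lim_seq_scal_l.
  apply (is_lim_seq_inv N p_infty); [|easy].
  apply (is_lim_seq_subseq INR p_infty (fun M => (2 * M + 1)%nat)); [|apply is_lim_seq_INR].
  apply eventually_subseq. intros n. lia.
Qed.

Let lim_r : is_lim_seq r 1.
Proof.
  rewrite <- exp_0. apply is_lim_seq_continuous.
  - apply derivable_continuous_pt, derivable_pt_exp.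
  - replace (Finite 0) with (Rbar_opp 0) by (simpl; f_equal; ring).
    apply -> is_lim_seq_opp. apply lim_w.
Qed.

Let lim_N1r : is_lim_seq (fun M => N M * (1 - r M)) (2 * PI * x).
Proof.
  apply (is_lim_seq_ext (fun M => 2 * PI * x * ((exp (- w M) - 1) / - w M))).
  { intros M. fold (r M). pose proof (N_pos M). pose proof PI_RGT_0. unfold w at 1.
    field. repeat split; lra. }
  replace (Finite (2 * PI * x)) with (Rbar_mult (2 * PI * x) 1) by (simpl; f_equal; ring).
  apply is_lim_seq_scal_l.
  apply (is_lim_comp_seq (fun h => (exp h - 1) / h) (fun M => - w M) 0).
  - apply is_lim_div_expm1_0.
  - exists O. intros M _ H. injection H. pose proof (w_pos M). lra.
  - replace (Finite 0) with (Rbar_opp 0) by (simpl; f_equal; ring).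
    apply -> is_lim_seq_opp. apply lim_w.
Qed.

Let lim_Nsin j : is_lim_seq (fun M => N M * sin (PI * INR j / N M)) (PI * INR j).
Proof.
  destruct j as [|j].
  - apply (is_lim_seq_ext (fun _ => PI * INR 0)); [|apply is_lim_seq_const].
    intros M. simpl. unfold Rdiv. rewrite Rmult_0_r, Rmult_0_l, sin_0. ring.
  - assert (HJ : 0 < INR (S j)) by (apply lt_0_INR; lia).
    pose proof PI_RGT_0 as HP.
    apply (is_lim_seq_ext (fun M => PI * INR (S j) *
      (sin (PI * INR (S j) / N M) / (PI * INR (S j) / N M)))).
    { intros M. pose proof (N_pos M). field. repeat split; lra. }
    replace (Finite (PI * INR (S j))) with (Rbar_mult (PI * INR (S j)) 1)
      by (simpl; f_equal; ring).
    apply is_lim_seq_scal_l.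
    apply (is_lim_comp_seq (fun h => sin h / h) (fun M => PI * INR (S j) / N M) 0).
    + apply is_lim_sinc_0.
    + exists O. intros M _ H. apply Rbar_finite_eq in H. pose proof (N_pos M).
      assert (0 < PI * INR (S j) / N M); [|lra].
      apply Rdiv_lt_0_compat; [apply Rmult_lt_0_compat|]; lra.
    + apply (is_lim_seq_ext (fun M => INR (S j) / (2 * x) * w M)).
      { intros M. pose proof (N_pos M). unfold w. field. repeat split; lra. }
      replace (Finite 0) with (Rbar_mult (INR (S j) / (2 * x)) 0) by (simpl; f_equal; ring).
      apply is_lim_seq_scal_l, lim_w.
Qed.

Let g (j : nat) : R := x / (PI * (x ^ 2 + INR j ^ 2)).

Let lim_f j : is_lim_seq (fun M => f M j) (g j).
Proof.
  pose proof PI_RGT_0 as HP.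
  pose proof (pow_lt x 2 Hx) as X2. pose proof (pow2_ge_0 (INR j)) as J2.
  assert (P2 : 0 < PI ^ 2) by (apply pow_lt, HP).
  assert (HD : 0 < x ^ 2 + INR j ^ 2) by lra.
  assert (HD' : 0 < PI ^ 2 * (x ^ 2 + INR j ^ 2)) by (apply Rmult_lt_0_compat; lra).
  apply (is_lim_seq_ext_loc (fun M => N M * (1 - r M) * (1 + r M) /
    ((N M * (1 - r M)) ^ 2 + 4 * r M * (N M * sin (PI * INR j / N M)) ^ 2))).
  { exists j. intros M H. symmetry. apply f_eq, H. }
  replace (g j) with ((2 * PI * x) * (1 + 1) /
    ((2 * PI * x) ^ 2 + 4 * 1 * (PI * INR j) ^ 2)).
  2:{ unfold g. field. split; nra. }
  apply (is_lim_seq_poisson_quotient _ _ r _ _ 1 lim_N1r (lim_Nsin j) lim_r). nra.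
Qed.

Let E : R := exp (- (2 * PI * x)).
Let alpha : R := (2 * PI * x * E) ^ 2.
(** Majorant of [f M j] free of [M]. In the form [f_eq] one has [E <= r M < 1],
    [2 PI x E <= N (1 - r) <= 2 PI x] and [N sin (PI j / N) >= j]; the first lower bound squared is
    [alpha]. *)
Let A (j : nat) : R := 2 * PI * x * 2 / (alpha + 4 * E * INR j ^ 2).

Let E_bound : 0 < E < 1.
Proof.
  pose proof PI_RGT_0. split; [apply exp_pos|]. unfold E. rewrite <- exp_0.
  apply exp_increasing. nra.
Qed.

Let alpha_pos : 0 < alpha.
Proof.
  pose proof PI_RGT_0. pose proof E_bound. apply pow_lt.
  apply Rmult_lt_0_compat; nra.
Qed.

Let f_le M j : Rabs (f M j) <= A j.
Proof.
  pose proof PI_RGT_0 as HP. pose proof E_bound as HE. pose proof alpha_pos as Ha.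
  assert (HA : 0 <= A j).
  { unfold A. apply Rlt_le, Rdiv_lt_0_compat; nra. }
  destruct (Nat.le_gt_cases j M) as [H|H].
  2:{ unfold f. apply Nat.leb_gt in H. rewrite H, Rabs_R0. exact HA. }
  rewrite f_eq by exact H.
  pose proof (N_pos M) as HN. pose proof (r_bound M) as Hr.
  assert (Ew : N M * w M = 2 * PI * x) by (unfold w; field; lra).
  assert (wle : w M <= 2 * PI * x) by (pose proof (w_pos M); nra).
  assert (rE : E <= r M).
  { unfold E, r. destruct (Req_dec (w M) (2 * PI * x)) as [->|]; [lra|].
    apply Rlt_le, exp_increasing. lra. }
  assert (U : N M * (1 - r M) <= 2 * PI * x).
  { rewrite <- Ew. apply Rmult_le_compat_l; [lra|].
    pose proof (one_add_le_exp (- w M)) as Q. fold (r M) in Q. lra. }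
  assert (L : 2 * PI * x * E <= N M * (1 - r M)).
  { rewrite <- Ew, Rmult_assoc. apply Rmult_le_compat_l; [lra|].
    apply (Rle_trans _ (w M * r M)); [pose proof (w_pos M); nra|].
    pose proof (one_add_le_exp (w M)) as Q.
    assert (Z : r M * exp (w M) = 1).
    { unfold r. rewrite <- exp_plus, Rplus_opp_l. apply exp_0. }
    nra. }
  assert (S1 : INR j <= N M * sin (PI * INR j / N M)).
  { assert (HJ : 0 <= INR j) by apply pos_INR.
    assert (HJM : 2 * INR j <= N M) by (rewrite N_eq; apply le_INR in H; lra).
    assert (H3 : 3 < PI) by (pose proof PI2_3_2; lra).
    assert (Z : PI * INR j / N M / 3 <= sin (PI * INR j / N M)).
    { apply sin_ge_third. split.
      - apply Rdiv_le_0_compat; nra.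
      - apply (Rmult_le_reg_r (N M)); [lra|].
        replace (PI * INR j / N M * N M) with (PI * INR j) by (field; lra). nra. }
    apply (Rmult_le_compat_l (N M)) in Z; [|lra].
    eapply Rle_trans; [|exact Z].
    replace (N M * (PI * INR j / N M / 3)) with (PI * INR j / 3) by (field; lra). nra. }
  pose proof (pos_INR j) as HJ.
  assert (P1 : 0 < N M * (1 - r M)) by (apply Rmult_lt_0_compat; lra).
  assert (D1 : alpha + 4 * E * INR j ^ 2 <=
    (N M * (1 - r M)) ^ 2 + 4 * r M * (N M * sin (PI * INR j / N M)) ^ 2).
  { apply Rplus_le_compat.
    - unfold alpha. apply pow_incr. split; [|exact L].
      apply Rmult_le_pos; nra.
    - apply Rmult_le_compat; [lra|nra|lra|]. apply pow_incr. lra. }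
  assert (D0 : 0 < alpha + 4 * E * INR j ^ 2) by nra.
  rewrite Rabs_pos_eq.
  2:{ apply Rlt_le, Rdiv_lt_0_compat; [apply Rmult_lt_0_compat|]; lra. }
  unfold A, Rdiv. apply Rmult_le_compat.
  - apply Rmult_le_pos; lra.
  - apply Rlt_le, Rinv_0_lt_compat. lra.
  - apply Rmult_le_compat; lra.
  - apply Rinv_le_contravar; lra.
Qed.

Let ex_A : ex_series A.
Proof.
  pose proof PI_RGT_0 as HP. pose proof E_bound as HE. pose proof alpha_pos as Ha.
  apply (ex_series_incr_1 (V := R_NormedModule)).
  apply (ex_series_abs_le _ (fun n => (PI * x / E) * / INR (S n) ^ 2)).
  2: apply ex_series_scal_R, ex_series_inv_sq.
  intros n. unfold A. assert (0 < INR (S n) ^ 2) by (apply pow_lt, lt_0_INR; lia).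
  set (y := INR (S n) ^ 2) in *.
  rewrite Rabs_pos_eq by (apply Rlt_le, Rdiv_lt_0_compat; nra).
  replace (PI * x / E * / y) with (2 * PI * x * 2 / (4 * E * y)) by (field; lra).
  apply Rmult_le_compat_l; [nra|]. apply Rinv_le_contravar; nra.
Qed.

Let g_le j : Rabs (g j) <= A j.
Proof.
  assert (H : is_lim_seq (fun M => Rabs (f M j)) (Rabs (g j))).
  { apply (is_lim_seq_abs _ (g j)), lim_f. }
  exact (is_lim_seq_le _ (fun _ => A j) (Rabs (g j)) (A j) (fun M => f_le M j) H
    (is_lim_seq_const _)).
Qed.

(** The right side is [PI coth (PI x)], written so that it later expands as a geometric series. It
    is the limit of the root-of-unity identity, in which [r M ^ (2 M + 1) = E] does not depend on
    [M]. *)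
Lemma coth_partial_fractions :
  ex_series (fun k => x / (x ^ 2 + INR (S k) ^ 2)) /\
  / x + 2 * Series (fun k => x / (x ^ 2 + INR (S k) ^ 2))
  = PI * (1 + exp (- (2 * PI * x))) / (1 - exp (- (2 * PI * x))).
Proof.
  pose proof PI_RGT_0 as HP. pose proof E_bound as HE. fold E.
  assert (Lf : is_lim_seq (fun M => Series (f M)) (Series g)).
  { apply (Series_dominated_lim f g A ex_A g_le); [|exact lim_f].
    apply filter_forall. intros M j. apply f_le. }
  assert (Ef : forall M, 2 * Series (f M) = (1 + E) / (1 - E) + f M O).
  { intros M. rewrite (is_series_unique _ _ (is_series_finite (f M) M ltac:(
      intros n Hn; unfold f; apply Nat.leb_gt in Hn; now rewrite Hn))).
    pose proof (poisson_kernel_sum (r M) M (r_bound M)) as H. fold (N M) in H.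
    pose proof (N_pos M) as HN.
    assert (Er : r M ^ (2 * M + 1) = E).
    { unfold r, E. rewrite pow_exp. f_equal. fold (N M). unfold w. field. lra. }
    rewrite Er in H.
    assert (E1 : sum_n (f M) M = / N M *
      sum_n (fun j => poisson_kernel (r M) (2 * PI * INR j / N M)) M).
    { rewrite <- (sum_n_mult_l (K := R_Ring)). apply sum_n_ext_loc. intros j Hj.
      unfold f. apply Nat.leb_le in Hj. rewrite Hj. apply Rmult_comm. }
    assert (E2 : f M O = / N M * poisson_kernel (r M) 0).
    { unfold f. simpl. unfold Rdiv. rewrite Rmult_0_r, Rmult_0_l. apply Rmult_comm. }
    rewrite E1, E2. apply (Rmult_eq_reg_l (N M)); [|lra].
    transitivity (2 * sum_n (fun j => poisson_kernel (r M) (2 * PI * INR j / N M)) M);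
      [field; lra|].
    replace (2 * sum_n (fun j => poisson_kernel (r M) (2 * PI * INR j / N M)) M)
      with (N M * (1 + E) / (1 - E) + poisson_kernel (r M) 0) by lra.
    field. lra. }
  assert (Hlim : 2 * Series g = (1 + E) / (1 - E) + g O).
  { assert (X : is_lim_seq (fun M => 2 * Series (f M)) (2 * Series g)).
    { apply (is_lim_seq_scal_l _ 2 (Series g)), Lf. }
    assert (Y : is_lim_seq (fun M => 2 * Series (f M)) ((1 + E) / (1 - E) + g O)).
    { apply (is_lim_seq_ext (fun M => (1 + E) / (1 - E) + f M O)); [now intros; rewrite Ef|].
      apply is_lim_seq_plus'; [apply is_lim_seq_const|apply lim_f]. }
    apply is_lim_seq_unique in X. apply is_lim_seq_unique in Y.
    rewrite X in Y. now injection Y. }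
  assert (Eg : ex_series g) by exact (ex_series_abs_le _ _ g_le ex_A).
  assert (Hg : forall k, x / (x ^ 2 + INR (S k) ^ 2) = PI * g (S k)).
  { intros k. unfold g. field. split; [|lra]. pose proof (pos_INR (S k)). nra. }
  split.
  - apply (ex_series_ext (fun k => PI * g (S k))); [now intros; rewrite Hg|].
    apply (ex_series_scal_R PI (fun k => g (S k))).
    now apply (ex_series_incr_1 (V := R_NormedModule) g).
  - rewrite (Series_ext _ _ Hg), Series_scal_l.
    rewrite (Series_incr_1 g Eg) in Hlim.
    assert (G0 : g O = / (PI * x)) by (unfold g; simpl; field; lra).
    rewrite G0 in Hlim.
    replace (2 * (PI * Series (fun k => g (S k)))) with
      (PI * (2 * (/ (PI * x) + Series (fun k => g (S k))) - 2 * / (PI * x))) by ring.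
    rewrite Hlim. field. lra.
Qed.

End PartialFractions.

(** * The Lipschitz formula *)

Definition freq (n : nat) : R := 2 * PI * INR (S n).

(** Up to the sign [(-1)^j], the [j]-th derivative of the series for [j = 0]. Index [n] stands for
    [n + 1]. *)
Definition exp_series (a : nat -> R) (j : nat) (t : R) : R :=
  Series (fun n => a n * freq n ^ j * exp (- (freq n * t))).

Lemma INR_S_ge_1 (n : nat) : 1 <= INR (S n).
Proof. rewrite S_INR. pose proof (pos_INR n). lra. Qed.

Lemma freq_pos (n : nat) : 0 < freq n.
Proof. unfold freq. pose proof PI_RGT_0. pose proof (INR_S_ge_1 n). nra. Qed.

(** Raise [1 + y / p <= exp (y / p)] to the power [p]; this gives [K = p^p]. *)
Lemma pow_le_exp (p : nat) : exists K, 0 < K /\ forall y, 0 <= y -> y ^ p <= K * exp y.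
Proof.
  destruct p as [|p].
  - exists 1. split; [lra|]. intros y Hy. simpl. pose proof (one_add_le_exp y). lra.
  - assert (HP : 0 < INR (S p)) by (apply lt_0_INR; lia).
    exists (INR (S p) ^ S p). split; [apply pow_lt, HP|]. intros y Hy.
    replace (exp y) with (exp (y / INR (S p)) ^ S p).
    + rewrite <- Rpow_mult_distr. apply pow_incr. split; [exact Hy|].
      pose proof (one_add_le_exp (y / INR (S p))) as H.
      apply (Rmult_le_compat_l (INR (S p))) in H; [|lra].
      replace (INR (S p) * (1 + y / INR (S p))) with (INR (S p) + y) in H by (field; lra).
      lra.
    + rewrite pow_exp. f_equal. field. lra.
Qed.

(** Half of the exponent absorbs the power and the other half leaves a geometric series. *)
Lemma ex_series_pow_exp (p : nat) (c : R) :
  0 < c -> ex_series (fun n => INR (S n) ^ p * exp (- (c * INR (S n)))).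
Proof.
  intros Hc. destruct (pow_le_exp p) as [K [HK H]].
  apply (ex_series_abs_le _ (fun n => K * (2 / c) ^ p * exp (- (c / 2)) ^ n)).
  - intros n. pose proof (INR_S_ge_1 n) as Hn. set (y := INR (S n)) in *.
    rewrite Rabs_pos_eq by (apply Rmult_le_pos; [apply pow_le; lra|apply Rlt_le, exp_pos]).
    rewrite pow_exp. assert (Hy : 0 <= c / 2 * y) by nra.
    specialize (H _ Hy). rewrite Rpow_mult_distr in H.
    apply (Rle_trans _ (K * (2 / c) ^ p * exp (c / 2 * y) * exp (- (c * y)))).
    + apply Rmult_le_compat_r; [apply Rlt_le, exp_pos|].
      apply (Rmult_le_compat_l ((2 / c) ^ p)) in H.
      2: apply pow_le, Rlt_le, Rdiv_lt_0_compat; lra.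
      rewrite <- Rmult_assoc, <- Rpow_mult_distr in H.
      replace (2 / c * (c / 2)) with 1 in H by (field; lra).
      rewrite pow1 in H. lra.
    + rewrite Rmult_assoc, <- exp_plus. apply Rmult_le_compat_l.
      * apply Rmult_le_pos; [lra|]. apply pow_le, Rlt_le, Rdiv_lt_0_compat; lra.
      * assert (L : c / 2 * y + - (c * y) <= INR n * - (c / 2)).
        { unfold y. rewrite S_INR. pose proof (pos_INR n). nra. }
        destruct L as [L|L]; [apply Rlt_le, exp_increasing, L|rewrite L; lra].
  - apply ex_series_scal_R, ex_series_geom. rewrite Rabs_pos_eq by apply Rlt_le, exp_pos.
    rewrite <- exp_0. apply exp_increasing. lra.
Qed.

Lemma exp_le (x y : R) : x <= y -> exp x <= exp y.
Proof. intros [H|H]; [apply Rlt_le, exp_increasing, H|rewrite H; lra]. Qed.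

Lemma exp_series_dominated (a : nat -> R) (p j : nat) (t : R) :
  0 < t -> (forall n, Rabs (a n) <= INR (S n) ^ p) ->
  exists M, ex_series M /\
    forall n y, t <= y -> Rabs (a n * freq n ^ j * exp (- (freq n * y))) <= M n.
Proof.
  intros Ht Ha. pose proof PI_RGT_0 as HP.
  exists (fun n => (2 * PI) ^ j * (INR (S n) ^ (p + j) * exp (- (2 * PI * t * INR (S n))))).
  split; [apply ex_series_scal_R, ex_series_pow_exp; nra|].
  intros n y Hy. pose proof (freq_pos n) as Hf.
  rewrite !Rabs_mult, (Rabs_pos_eq (exp _)), (Rabs_pos_eq (freq n ^ j));
    [|apply pow_le; lra|apply Rlt_le, exp_pos].
  rewrite pow_add.
  replace ((2 * PI) ^ j * (INR (S n) ^ p * INR (S n) ^ j * exp (- (2 * PI * t * INR (S n)))))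
    with (INR (S n) ^ p * ((2 * PI) ^ j * INR (S n) ^ j) * exp (- (2 * PI * t * INR (S n))))
    by ring.
  rewrite <- Rpow_mult_distr. fold (freq n).
  apply Rmult_le_compat; [|apply Rlt_le, exp_pos| |].
  - apply Rmult_le_pos; [apply Rabs_pos|apply pow_le; lra].
  - apply Rmult_le_compat_r; [apply pow_le; lra|apply Ha].
  - apply exp_le. replace (2 * PI * t * INR (S n)) with (freq n * t) by (unfold freq; ring).
    nra.
Qed.

Lemma ex_exp_series (a : nat -> R) (p j : nat) (t : R) :
  0 < t -> (forall n, Rabs (a n) <= INR (S n) ^ p) ->
  ex_series (fun n => a n * freq n ^ j * exp (- (freq n * t))).
Proof.
  intros Ht Ha. destruct (exp_series_dominated a p j t Ht Ha) as [M [HM H]].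
  apply (ex_series_abs_le _ M); [|exact HM]. intros n. apply H. lra.
Qed.

Lemma is_derive_exp_series (a : nat -> R) (p j : nat) (t : R) :
  0 < t -> (forall n, Rabs (a n) <= INR (S n) ^ p) ->
  is_derive (exp_series a j) t (- exp_series a (S j) t).
Proof.
  intros Ht Ha.
  destruct (exp_series_dominated a p (S j) (t / 2) ltac:(lra) Ha) as [M [HM H]].
  unfold exp_series. rewrite <- Series_opp.
  assert (I : forall y, Rabs (y - t) < t / 2 -> t / 2 <= y).
  { intros y Hy. apply Rabs_def2 in Hy. lra. }
  apply (is_derive_Series (fun n y => a n * freq n ^ j * exp (- (freq n * y)))
    (fun n y => - (a n * freq n ^ S j * exp (- (freq n * y)))) M t (t / 2)); [lra| | |exact HM|].
  - intros n y _. auto_derive; [trivial|]. simpl pow. ring.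
  - intros n y Hy. rewrite Rabs_Ropp. apply H, I, Hy.
  - intros y Hy. apply (ex_exp_series a p j y); [|exact Ha]. apply I in Hy. lra.
Qed.

(* Real and imaginary parts of [(x + i k)^(-j)]. *)
Fixpoint inv_cpow (x k : R) (j : nat) : R * R :=
  match j with
  | O => (1, 0)
  | S i =>
      let p := fst (inv_cpow x k i) in
      let q := snd (inv_cpow x k i) in
      ((x * p + k * q) / (x ^ 2 + k ^ 2), (x * q - k * p) / (x ^ 2 + k ^ 2))
  end.

Lemma inv_cpow_norm (x k : R) (j : nat) :
  x ^ 2 + k ^ 2 <> 0 ->
  fst (inv_cpow x k j) ^ 2 + snd (inv_cpow x k j) ^ 2 = / (x ^ 2 + k ^ 2) ^ j.
Proof.
  intros H. induction j as [|j IH].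
  - simpl. field.
  - simpl fst. simpl snd. set (p := fst _) in *. set (q := snd _) in *.
    transitivity ((p ^ 2 + q ^ 2) * / (x ^ 2 + k ^ 2)).
    + field. exact H.
    + rewrite IH, <- Rinv_mult. simpl. f_equal. ring.
Qed.

Lemma is_derive_inv_cpow (x k : R) (j : nat) :
  x ^ 2 + k ^ 2 <> 0 ->
  is_derive (fun y => fst (inv_cpow y k j)) x (- INR j * fst (inv_cpow x k (S j))) /\
  is_derive (fun y => snd (inv_cpow y k j)) x (- INR j * snd (inv_cpow x k (S j))).
Proof.
  intros H. induction j as [|j [IHp IHq]].
  - simpl. split; auto_derive; trivial; ring.
  - rewrite S_INR. simpl fst in *. simpl snd in *.
    set (f := fun y => fst (inv_cpow y k j)) in *.
    set (g := fun y => snd (inv_cpow y k j)) in *.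
    change (fst (inv_cpow x k j)) with (f x) in *.
    change (snd (inv_cpow x k j)) with (g x) in *.
    split.
    + apply (is_derive_ext (fun y => (y * f y + k * g y) / (y ^ 2 + k ^ 2))); [reflexivity|].
      auto_derive.
      * repeat split; try (eexists; eassumption). simpl in *; lra.
      * rewrite (is_derive_unique (fun y : R => f y : R) x _ IHp),
          (is_derive_unique (fun y : R => g y : R) x _ IHq).
        field. intros Z. apply H. rewrite <- Z. ring.
    + apply (is_derive_ext (fun y => (y * g y - k * f y) / (y ^ 2 + k ^ 2))); [reflexivity|].
      auto_derive.
      * repeat split; try (eexists; eassumption). simpl in *; lra.
      * rewrite (is_derive_unique (fun y : R => f y : R) x _ IHp),
          (is_derive_unique (fun y : R => g y : R) x _ IHq).
        field. intros Z. apply H. rewrite <- Z. ring.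
Qed.

(** The modulus of [x + i k] is at least [x0] and at least [k]; [j] of the [j + 2] factors are
    bounded by the first and two by the second, which gives summability in [k]. *)
Lemma inv_cpow_bound (x0 x : R) (j k : nat) :
  0 < x0 <= x ->
  Rabs (fst (inv_cpow x (INR (S k)) (S (S j)))) <= / x0 ^ j * / INR (S k) ^ 2.
Proof.
  intros [H0 H1]. pose proof (INR_S_ge_1 k) as Hk. set (y := INR (S k)) in *.
  assert (Hx : x0 ^ 2 <= x ^ 2) by (apply pow_incr; lra).
  assert (X0 : 0 < x0 ^ 2) by (apply pow_lt; lra).
  assert (Y0 : 0 < y ^ 2) by (apply pow_lt; lra).
  pose proof (inv_cpow_norm x y (S (S j)) ltac:(lra)) as HN.
  set (p := fst _) in *. set (q := snd _) in *.
  assert (P : 0 < / x0 ^ j * / y ^ 2).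
  { apply Rmult_lt_0_compat; apply Rinv_0_lt_compat; [apply pow_lt|]; lra. }
  rewrite <- (Rabs_pos_eq (/ x0 ^ j * / y ^ 2)) by lra.
  apply Rsqr_le_abs_0. rewrite !Rsqr_pow2.
  apply (Rle_trans _ (/ (x ^ 2 + y ^ 2) ^ S (S j))).
  - rewrite <- HN. pose proof (pow2_ge_0 q). lra.
  - replace ((/ x0 ^ j * / y ^ 2) ^ 2) with (/ ((x0 ^ 2) ^ j * (y ^ 2) ^ 2)).
    + apply Rinv_le_contravar.
      * apply Rmult_lt_0_compat; apply pow_lt; lra.
      * replace (S (S j)) with (j + 2)%nat by lia. rewrite pow_add.
        apply Rmult_le_compat; try (apply pow_le; lra); apply pow_incr; lra.
    + rewrite <- Rinv_mult, pow_inv. f_equal. rewrite <- pow_mult, Nat.mul_comm, pow_mult. ring.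
Qed.

(** Half of the sum of [(x + i k)^(-j)] over all integers [k], with [k] and [-k] paired. The pairing
    leaves real parts, whose series converges already for [j = 1]. *)
Definition lattice_row (j : nat) (x : R) : R :=
  / (2 * x ^ j) + Series (fun k => fst (inv_cpow x (INR (S k)) j)).

Lemma ex_series_inv_cpow (j : nat) (x : R) :
  0 < x -> ex_series (fun k => fst (inv_cpow x (INR (S k)) (S j))).
Proof.
  intros Hx. destruct j as [|j].
  - apply (ex_series_ext (fun k => x / (x ^ 2 + INR (S k) ^ 2))).
    + intros k. cbn [inv_cpow fst snd]. unfold Rdiv. now rewrite Rmult_0_r, Rplus_0_r, Rmult_1_r.
    + apply coth_partial_fractions, Hx.
  - apply (ex_series_abs_le _ (fun k => / x ^ j * / INR (S k) ^ 2)).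
    + intros k. apply inv_cpow_bound. lra.
    + apply ex_series_scal_R, ex_series_inv_sq.
Qed.

Lemma is_derive_lattice_row (j : nat) (x : R) :
  0 < x -> is_derive (lattice_row (S j)) x (- INR (S j) * lattice_row (S (S j)) x).
Proof.
  intros Hx. unfold lattice_row. rewrite Rmult_plus_distr_l, <- Series_scal_l.
  assert (I : forall y, Rabs (y - x) < x / 2 -> x / 2 <= y).
  { intros y Hy. apply Rabs_def2 in Hy. lra. }
  apply (is_derive_plus (V := R_NormedModule) (fun y => / (2 * y ^ S j))).
  - auto_derive.
    + apply Rmult_integral_contrapositive. split; [lra|]. apply (pow_nonzero x (S j)). lra.
    + change (match j with O => 1 | S _ => INR j + 1 end) with (INR (S j)).
      simpl pow. field. split; [apply pow_nonzero|]; lra.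
  - apply (is_derive_Series (fun k y => fst (inv_cpow y (INR (S k)) (S j)))
      (fun k y => - INR (S j) * fst (inv_cpow y (INR (S k)) (S (S j))))
      (fun k => INR (S j) * (/ (x / 2) ^ j * / INR (S k) ^ 2)) x (x / 2)); [lra| | | |].
    + intros k y Hy. apply is_derive_inv_cpow. pose proof (INR_S_ge_1 k). apply I in Hy. nra.
    + intros k y Hy. rewrite Rabs_mult, Rabs_Ropp, Rabs_pos_eq by apply pos_INR.
      apply Rmult_le_compat_l; [apply pos_INR|]. apply inv_cpow_bound.
      split; [lra|apply I, Hy].
    + do 2 apply ex_series_scal_R. apply ex_series_inv_sq.
    + intros y Hy. apply ex_series_inv_cpow. apply I in Hy. lra.
Qed.

Lemma exp_series_one_0 (x : R) :
  0 < x -> exp_series (fun _ => 1) 0 x = / PI * lattice_row 1 x - / 2.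
Proof.
  intros Hx. pose proof PI_RGT_0 as HP.
  destruct (coth_partial_fractions x Hx) as [E H].
  assert (R1 : lattice_row 1 x = PI / 2 * (1 + exp (- (2 * PI * x))) / (1 - exp (- (2 * PI * x)))).
  { unfold lattice_row.
    rewrite (Series_ext _ (fun k => x / (x ^ 2 + INR (S k) ^ 2))).
    2:{ intros k. cbn [inv_cpow fst snd]. unfold Rdiv.
        now rewrite Rmult_0_r, Rplus_0_r, Rmult_1_r. }
    replace (/ (2 * x ^ 1)) with (/ x / 2) by (field; lra).
    unfold Rdiv in *. lra. }
  rewrite R1. unfold exp_series. set (e := exp (- (2 * PI * x))).
  assert (He : 0 < e < 1).
  { split; [apply exp_pos|]. unfold e. rewrite <- exp_0. apply exp_increasing. nra. }
  rewrite (Series_ext _ (fun n => e * e ^ n)).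
  2:{ intros n. unfold e, freq. rewrite pow_exp, <- exp_plus, Rmult_1_l, S_INR. simpl.
      rewrite Rmult_1_l. f_equal. ring. }
  rewrite Series_scal_l, Series_geom by (rewrite Rabs_pos_eq; lra). field. lra.
Qed.

(* The Lipschitz formula, obtained by differentiating the partial fraction
   expansion of the hyperbolic cotangent. *)
Lemma exp_series_one_S (j : nat) (x : R) :
  0 < x -> exp_series (fun _ => 1) (S j) x = INR (fact (S j)) / PI * lattice_row (S (S j)) x.
Proof.
  assert (Ha : forall n, Rabs 1 <= INR (S n) ^ 0) by (intros; simpl; rewrite Rabs_R1; lra).
  pose proof PI_RGT_0 as HP.
  (* The additive constant [c] is there for the start of the induction, where it is [- / 2]; one
     differentiation removes it. *)
  assert (G : forall j c, (forall x, 0 < x ->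
      exp_series (fun _ => 1) j x = INR (fact j) / PI * lattice_row (S j) x + c) ->
    forall x, 0 < x ->
      exp_series (fun _ => 1) (S j) x = INR (fact (S j)) / PI * lattice_row (S (S j)) x + 0).
  { clear j x. intros j c H x Hx.
    pose proof (is_derive_exp_series (fun _ => 1) 0 j x Hx Ha) as D1.
    assert (D2 : is_derive (exp_series (fun _ => 1) j) x
      (INR (fact j) / PI * (- INR (S j) * lattice_row (S (S j)) x))).
    { apply (is_derive_ext_loc (fun y => INR (fact j) / PI * lattice_row (S j) y + c)).
      - exists (mkposreal x Hx). intros y Hy. symmetry. apply H.
        change (Rabs (y - x) < x) in Hy. apply Rabs_def2 in Hy. lra.
      - pose proof (is_derive_lattice_row j x Hx) as D.
        auto_derive; [eexists; exact D|].
        rewrite (is_derive_unique (fun y : R => lattice_row (S j) y : R) x _ D). ring. }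
    apply is_derive_unique in D1. apply is_derive_unique in D2. rewrite D1 in D2.
    rewrite fact_simpl, mult_INR.
    replace (exp_series (fun _ => 1) (S j) x) with (- - exp_series (fun _ => 1) (S j) x) by ring.
    rewrite D2. field. lra. }
  assert (H : forall x, 0 < x ->
    exp_series (fun _ => 1) (S j) x = INR (fact (S j)) / PI * lattice_row (S (S j)) x + 0).
  { induction j as [|j IH].
    - apply (G O (- / 2)). intros y Hy. rewrite exp_series_one_0 by exact Hy. simpl. field. lra.
    - exact (G (S j) 0 IH). }
  intros Hx. rewrite H by exact Hx. ring.
Qed.

(** * Behaviour of Eisenstein series under inversion *)

Lemma inv_cpow_2 (x k : R) :
  x ^ 2 + k ^ 2 <> 0 ->
  fst (inv_cpow x k 2) = (x ^ 2 - k ^ 2) / (x ^ 2 + k ^ 2) ^ 2.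
Proof. intros H. cbn [inv_cpow fst snd]. field. exact H. Qed.

Lemma inv_cpow_4 (x k : R) :
  x ^ 2 + k ^ 2 <> 0 ->
  fst (inv_cpow x k 4) =
  (x ^ 4 - 6 * x ^ 2 * k ^ 2 + k ^ 4) / (x ^ 2 + k ^ 2) ^ 4.
Proof. intros H. cbn [inv_cpow fst snd]. field. exact H. Qed.

Lemma inv_cpow_6 (x k : R) :
  x ^ 2 + k ^ 2 <> 0 ->
  fst (inv_cpow x k 6) =
  (x ^ 6 - 15 * x ^ 4 * k ^ 2 + 15 * x ^ 2 * k ^ 4 - k ^ 6) / (x ^ 2 + k ^ 2) ^ 6.
Proof. intros H. cbn [inv_cpow fst snd]. field. exact H. Qed.

(** Since [m / t + i k = (i / t) (k t - i m)] and conjugation keeps real parts, this holds for even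
    [w] with [s = (-1)^(w / 2)]. *)
Definition inv_cpow_symmetric (w : nat) (s : R) : Prop :=
  forall t m k, 0 < t -> 0 < m -> 0 < k ->
  fst (inv_cpow (m * / t) k w) = s * t ^ w * fst (inv_cpow (k * t) m w).

Lemma inv_cpow_symmetric_2 : inv_cpow_symmetric 2 (-1).
Proof.
  intros t m k Ht Hm Hk. assert (0 < / t) by (apply Rinv_0_lt_compat, Ht).
  assert (0 < m * / t) by (apply Rmult_lt_0_compat; lra).
  assert (0 < k * t) by (apply Rmult_lt_0_compat; lra).
  rewrite !inv_cpow_2 by nra. field. repeat split; nra.
Qed.

Lemma inv_cpow_symmetric_4 : inv_cpow_symmetric 4 1.
Proof.
  intros t m k Ht Hm Hk. assert (0 < / t) by (apply Rinv_0_lt_compat, Ht).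
  assert (0 < m * / t) by (apply Rmult_lt_0_compat; lra).
  assert (0 < k * t) by (apply Rmult_lt_0_compat; lra).
  rewrite !inv_cpow_4 by nra. field. repeat split; nra.
Qed.

Lemma inv_cpow_symmetric_6 : inv_cpow_symmetric 6 (-1).
Proof.
  intros t m k Ht Hm Hk. assert (0 < / t) by (apply Rinv_0_lt_compat, Ht).
  assert (0 < m * / t) by (apply Rmult_lt_0_compat; lra).
  assert (0 < k * t) by (apply Rmult_lt_0_compat; lra).
  rewrite !inv_cpow_6 by nra. field. repeat split; nra.
Qed.

(** This is sigma_a at [n + 1], with [d] standing for the divisor [d + 1]; [INR_divisor_sigma] below
    identifies it with [divisor_sigma]. *)
Definition sigma_coef (a n : nat) : R :=
  sum_n (fun d => if (S n mod S d =? 0)%nat then INR (S d) ^ a else 0) n.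

Lemma Series_single (c : nat) (y : R) :
  Series (fun n => if (n =? c)%nat then y else 0) = y.
Proof.
  apply is_series_unique.
  assert (E : sum_n (fun n => if (n =? c)%nat then y else 0) c = y).
  { assert (Z : forall N, (N < c)%nat ->
      sum_n (fun n => if (n =? c)%nat then y else 0) N = 0 :> R).
    { intros N HN. rewrite (sum_n_ext_loc _ (fun _ => 0)).
      - rewrite sum_n_const. apply Rmult_0_r.
      - intros n Hn. destruct (Nat.eqb_spec n c); [lia|reflexivity]. }
    destruct c as [|c].
    - rewrite sum_n_0. reflexivity.
    - rewrite sum_n_succ, Z, Nat.eqb_refl by lia. apply Rplus_0_l. }
  pose proof (is_series_finite (fun n => if (n =? c)%nat then y else 0) c) as H.
  apply (eq_ind _ (is_series _) (H ltac:(
    intros n Hn; cbv beta; destruct (Nat.eqb_spec n c); [lia|reflexivity])) y E).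
Qed.

Lemma Series_finite (a : nat -> R) (N : nat) :
  (forall n, (N < n)%nat -> a n = 0) -> Series a = sum_n a N.
Proof. intros H. apply is_series_unique, is_series_finite, H. Qed.

(** * Lambert series of the divisor sums *)

Section Lambert.

Variable t : R.
Hypothesis Ht : 0 < t.

Let w (n : nat) : R := exp (- (freq n * t)).
(** Half of the decay rate [2 PI t]: the decay of a double series is shared between its two indices,
    giving a product majorant. *)
Let B (p n : nat) : R := INR (S n) ^ p * exp (- (PI * t * INR (S n))).

Let ex_B p : ex_series (B p).
Proof. apply ex_series_pow_exp. pose proof PI_RGT_0. nra. Qed.

Let B_pos p n : 0 <= B p n.
Proof. apply Rmult_le_pos; [apply pow_le, pos_INR|apply Rlt_le, exp_pos]. Qed.

Lemma Series_multiples (d : nat) :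
  Series (fun n => if (S n mod S d =? 0)%nat then w n else 0) =
  Series (fun m => exp (- (freq d * (INR (S m) * t)))).
Proof.
  pose proof PI_RGT_0 as HP.
  (* [x] is supported on [n + 1 = (d + 1) (m + 1)], so summing over [m] first detects divisibility
     and summing over [n] first parametrises the multiples. *)
  set (x := fun m n : nat => if (n =? Nat.pred (S d * S m))%nat then w n else 0).
  transitivity (Series (fun n => Series (fun m => x m n))).
  - apply Series_ext. intros n.
    destruct (Nat.eqb_spec (S n mod S d) 0) as [H|H].
    + apply Nat.Div0.div_exact in H.
      rewrite (Series_ext _ (fun m => if (m =? Nat.pred (S n / S d))%nat then w n else 0)).
      * symmetry. apply Series_single.
      * intros m. unfold x.
        destruct (Nat.eqb_spec n (Nat.pred (S d * S m))) as [H1|H1];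
        destruct (Nat.eqb_spec m (Nat.pred (S n / S d))) as [H2|H2]; auto; exfalso.
        -- apply H2. assert (S n = S d * S m)%nat by lia.
           rewrite H0, Nat.mul_comm, Nat.div_mul by lia. lia.
        -- apply H1. destruct (S n / S d)%nat eqn:Q; [lia|]. subst m. simpl Nat.pred at 2. lia.
    + symmetry. rewrite (Series_ext _ (fun _ => 0)).
      * rewrite (Series_finite _ O) by auto. apply sum_n_0.
      * intros m. unfold x. destruct (Nat.eqb_spec n (Nat.pred (S d * S m))) as [H1|H1]; auto.
        exfalso. apply H. replace (S n) with (S m * S d)%nat by lia. apply Nat.Div0.mod_mul.
  - rewrite <- (Series_swap x (B 0) (B 0) (ex_B 0) (ex_B 0)).
    + apply Series_ext. intros m. unfold x.
      rewrite (Series_ext _ (fun n => if (n =? Nat.pred (S d * S m))%nat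
        then w (Nat.pred (S d * S m)) else 0)).
      2:{ intros n. destruct (Nat.eqb_spec n (Nat.pred (S d * S m))); subst; auto. }
      rewrite Series_single. unfold w. do 2 f_equal. unfold freq.
      replace (S (Nat.pred (S d * S m))) with (S d * S m)%nat by lia.
      rewrite mult_INR. ring.
    + intros m n. unfold x.
      destruct (Nat.eqb_spec n (Nat.pred (S d * S m))) as [H|H].
      2:{ rewrite Rabs_R0. apply Rmult_le_pos; apply B_pos. }
      rewrite Rabs_pos_eq by apply Rlt_le, exp_pos. unfold B, w. simpl pow.
      rewrite !Rmult_1_l, <- exp_plus. apply exp_le. unfold freq.
      assert (L : INR (S m) <= INR (S n)) by (apply le_INR; lia).
      assert (PI * t * INR (S m) <= PI * t * INR (S n)); [|lra].
      apply Rmult_le_compat_l; [nra|exact L].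
Qed.

(** Writing [n = d m] turns [sum_n sigma_a(n) q^n] into [sum_m sum_d d^a q^(d m)]. The power of
    [2 PI] undoes the use of [freq d ^ a] in place of [d^a]. *)
Lemma Lambert_series (a : nat) :
  ex_series (fun m => exp_series (fun _ => 1) a (INR (S m) * t)) /\
  exp_series (sigma_coef a) 0 t =
  / (2 * PI) ^ a * Series (fun m => exp_series (fun _ => 1) a (INR (S m) * t)).
Proof.
  pose proof PI_RGT_0 as HP.
  assert (HPa : 0 < (2 * PI) ^ a) by (apply pow_lt; lra).
  set (z := fun m d : nat => freq d ^ a * exp (- (freq d * (INR (S m) * t)))).
  assert (Hz : forall m d, Rabs (z m d) <= B 0 m * ((2 * PI) ^ a * B a d)).
  { intros m d. unfold z. pose proof (freq_pos d) as Hf.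
    rewrite Rabs_pos_eq
      by (apply Rmult_le_pos; [apply pow_le; lra|apply Rlt_le, exp_pos]).
    unfold B.
    replace (INR (S m) ^ 0 * exp (- (PI * t * INR (S m))) *
      ((2 * PI) ^ a * (INR (S d) ^ a * exp (- (PI * t * INR (S d))))))
      with (((2 * PI) ^ a * INR (S d) ^ a) *
        (exp (- (PI * t * INR (S m))) * exp (- (PI * t * INR (S d))))) by (simpl; ring).
    rewrite <- Rpow_mult_distr, <- exp_plus. fold (freq d).
    apply Rmult_le_compat_l; [apply pow_le; lra|]. apply exp_le. unfold freq.
    pose proof (INR_S_ge_1 m). pose proof (INR_S_ge_1 d).
    assert (INR (S m) + INR (S d) <= 2 * (INR (S m) * INR (S d))) by nra.
    assert (PI * t * (INR (S m) + INR (S d)) <= PI * t * (2 * (INR (S m) * INR (S d))));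
      [|lra].
    apply Rmult_le_compat_l; [nra|assumption]. }
  assert (ex_Ba : ex_series (fun d => (2 * PI) ^ a * B a d)) by apply ex_series_scal_R, ex_B.
  assert (Ez : forall m, Series (z m) = exp_series (fun _ => 1) a (INR (S m) * t)).
  { intros m. apply Series_ext. intros d. unfold z. ring. }
  split.
  { apply (ex_series_ext (fun m => Series (z m))); [exact Ez|].
    exact (ex_series_Series_row z _ _ (ex_B 0) ex_Ba Hz). }
  rewrite <- (Series_ext _ _ Ez), (Series_swap z _ _ (ex_B 0) ex_Ba Hz), <- Series_scal_l.
  (* The cutoff [d <= n], implied by divisibility, makes rows finite and lets
     [exp (- 2 PI t (n + 1))] be split between [n] and [d]. *)
  set (y := fun n d : nat => if (S n mod S d =? 0)%nat
    then (if (d <=? n)%nat then INR (S d) ^ a * w n else 0) else 0).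
  assert (Hy : forall n d, Rabs (y n d) <= B 0 n * B a d).
  { intros n d. unfold y.
    assert (P : 0 <= B 0 n * B a d) by (apply Rmult_le_pos; apply B_pos).
    destruct (S n mod S d =? 0)%nat; [|rewrite Rabs_R0; exact P].
    destruct (Nat.leb_spec d n) as [H|H]; [|rewrite Rabs_R0; exact P].
    rewrite Rabs_pos_eq
      by (apply Rmult_le_pos; [apply pow_le, pos_INR|apply Rlt_le, exp_pos]).
    unfold B, w.
    replace (INR (S n) ^ 0 * exp (- (PI * t * INR (S n))) *
      (INR (S d) ^ a * exp (- (PI * t * INR (S d)))))
      with (INR (S d) ^ a *
        (exp (- (PI * t * INR (S n))) * exp (- (PI * t * INR (S d))))) by (simpl; ring).
    rewrite <- exp_plus. apply Rmult_le_compat_l; [apply pow_le, pos_INR|].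
    apply exp_le. unfold freq.
    assert (PI * t * INR (S d) <= PI * t * INR (S n)); [|lra].
    apply Rmult_le_compat_l; [nra|]. apply le_INR. lia. }
  transitivity (Series (fun n => Series (y n))).
  - apply Series_ext. intros n. rewrite (Series_finite (y n) n).
    2:{ intros d Hd. unfold y. apply Nat.leb_gt in Hd. rewrite Hd.
        now destruct (S n mod S d =? 0)%nat. }
    unfold sigma_coef. fold (w n).
    transitivity (w n * sum_n
      (fun d => if (S n mod S d =? 0)%nat then INR (S d) ^ a else 0) n); [simpl; ring|].
    rewrite <- (sum_n_mult_l (K := R_Ring)). apply sum_n_ext_loc. intros d Hd.
    unfold y. apply Nat.leb_le in Hd. rewrite Hd.
    destruct (S n mod S d =? 0)%nat; [apply Rmult_comm|apply Rmult_0_r].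
  - rewrite (Series_swap y _ _ (ex_B 0) (ex_B a) Hy). apply Series_ext. intros d.
    rewrite (Series_ext _ (fun n => INR (S d) ^ a * (if (S n mod S d =? 0)%nat then w n else 0))).
    + rewrite Series_scal_l, Series_multiples. unfold z. rewrite Series_scal_l.
      rewrite <- Rmult_assoc. f_equal. unfold freq. rewrite (Rpow_mult_distr (2 * PI)). field. lra.
    + intros n. unfold y. destruct (Nat.eqb_spec (S n mod S d) 0) as [H|H]; [|ring].
      destruct (Nat.leb_spec d n) as [L|L]; [reflexivity|].
      rewrite Nat.mod_small in H by lia. discriminate.
Qed.

End Lambert.

(** The Lipschitz constant times the Lambert factor: [2 (w - 1)! / (2 PI)^w] for weight
    [w = j + 2]. *)
Definition eisenstein_factor (j : nat) : R :=
  INR (fact (S j)) / PI * / (2 * PI) ^ S j.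

(** The inner sum is over [k], the imaginary direction; for [w = 2] this order affects the value. *)
Definition inv_cpow_double_sum (w : nat) (t : R) : R :=
  Series (fun m => Series (fun k => fst (inv_cpow (INR (S m) * t) (INR (S k)) w))).

Definition zeta_sum (w : nat) : R := Series (fun m => / INR (S m) ^ w).

Lemma ex_series_zeta (j : nat) : ex_series (fun m => / INR (S m) ^ S (S j)).
Proof.
  apply (ex_series_abs_le _ (fun m => / INR (S m) ^ 2)); [|apply ex_series_inv_sq].
  intros m. pose proof (INR_S_ge_1 m) as H.
  rewrite Rabs_pos_eq by (apply Rlt_le, Rinv_0_lt_compat, pow_lt; lra).
  apply Rinv_le_contravar; [apply pow_lt; lra|]. apply Rle_pow; [lra|lia].
Qed.

(** The Lipschitz formula in each row of the Lambert series. The column [k = 0], with weight one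
    half, gives the zeta term. *)
Lemma sigma_exp_series_lattice (j : nat) (t : R) :
  0 < t ->
  ex_series (fun m =>
    Series (fun k => fst (inv_cpow (INR (S m) * t) (INR (S k)) (S (S j))))) /\
  exp_series (sigma_coef (S j)) 0 t = eisenstein_factor j *
    (zeta_sum (S (S j)) / (2 * t ^ S (S j)) + inv_cpow_double_sum (S (S j)) t).
Proof.
  intros Ht. pose proof PI_RGT_0 as HP.
  assert (HF : 0 < INR (fact (S j))) by apply INR_fact_lt_0.
  destruct (Lambert_series t Ht (S j)) as [E1 E2].
  assert (Hm : forall m, 0 < INR (S m) * t).
  { intros m. pose proof (INR_S_ge_1 m). nra. }
  assert (L : forall m, exp_series (fun _ => 1) (S j) (INR (S m) * t) =
    INR (fact (S j)) / PI * lattice_row (S (S j)) (INR (S m) * t)).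
  { intros m. apply exp_series_one_S, Hm. }
  assert (EL : ex_series (fun m => lattice_row (S (S j)) (INR (S m) * t))).
  { apply (ex_series_ext (fun m => PI / INR (fact (S j)) *
      exp_series (fun _ => 1) (S j) (INR (S m) * t))).
    - intros m. rewrite L.
      apply Rmult_eq_reg_l with (INR (fact (S j)) / PI);
        [|apply Rgt_not_eq, Rdiv_lt_0_compat; lra].
      field. lra.
    - apply ex_series_scal_R, E1. }
  assert (Hz : forall m, / (2 * (INR (S m) * t) ^ S (S j)) =
    / (2 * t ^ S (S j)) * / INR (S m) ^ S (S j)).
  { intros m. rewrite Rpow_mult_distr, !Rinv_mult. ring. }
  assert (EZ : ex_series (fun m => / (2 * (INR (S m) * t) ^ S (S j)))).
  { apply (ex_series_ext (fun m => / (2 * t ^ S (S j)) * / INR (S m) ^ S (S j))).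
    - intros m. symmetry. apply Hz.
    - apply ex_series_scal_R, ex_series_zeta. }
  assert (ED : ex_series (fun m =>
    Series (fun k => fst (inv_cpow (INR (S m) * t) (INR (S k)) (S (S j)))))).
  { apply (ex_series_ext (fun m => minus (lattice_row (S (S j)) (INR (S m) * t))
      (/ (2 * (INR (S m) * t) ^ S (S j))))).
    - intros m. unfold lattice_row, minus, plus, opp; simpl. ring.
    - apply (ex_series_minus (V := R_NormedModule)); assumption. }
  split; [exact ED|].
  rewrite E2, (Series_ext _ _ L), Series_scal_l. unfold lattice_row at 1.
  rewrite Series_plus by assumption. rewrite (Series_ext _ _ Hz), Series_scal_l.
  unfold eisenstein_factor, zeta_sum, inv_cpow_double_sum, Rdiv. ring.
Qed.

(** Only the terms are transformed, so the index multiplied by [t] is now summed first. Restoring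
    the order is the analytic step, done separately for [w >= 4] and [w = 2]. *)
Lemma inv_cpow_double_sum_inversion (w : nat) (s t : R) :
  inv_cpow_symmetric w s -> 0 < t ->
  inv_cpow_double_sum w (/ t) =
  s * t ^ w *
    Series (fun m => Series (fun k => fst (inv_cpow (INR (S k) * t) (INR (S m)) w))).
Proof.
  intros Hs Ht. unfold inv_cpow_double_sum. rewrite <- Series_scal_l.
  apply Series_ext. intros m. rewrite <- Series_scal_l. apply Series_ext. intros k.
  pose proof (INR_S_ge_1 m). pose proof (INR_S_ge_1 k). apply Hs; lra.
Qed.

(** With [w >= 4], two powers go to [k] and at least two remain for [m], so the majorant is summable
    in both indices. *)
Lemma inv_cpow_double_sum_swap (j : nat) (t : R) :
  0 < t ->
  Series (fun m => Series (fun k => fst (inv_cpow (INR (S k) * t) (INR (S m)) (4 + j)))) =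
  inv_cpow_double_sum (4 + j) t.
Proof.
  intros Ht. symmetry.
  apply (Series_swap (fun m k => fst (inv_cpow (INR (S m) * t) (INR (S k)) (4 + j)))
    (fun m => / t ^ S (S j) * / INR (S m) ^ 2) (fun k => / INR (S k) ^ 2)).
  - apply ex_series_scal_R, ex_series_inv_sq.
  - apply ex_series_inv_sq.
  - intros m k. pose proof (INR_S_ge_1 m) as Hm.
    assert (Hmt : 0 < INR (S m) * t) by nra.
    eapply Rle_trans; [apply (inv_cpow_bound (INR (S m) * t) _ (S (S j))); lra|].
    apply Rmult_le_compat_r.
    { apply Rlt_le, Rinv_0_lt_compat, pow_lt. pose proof (INR_S_ge_1 k). lra. }
    rewrite Rpow_mult_distr, Rinv_mult, Rmult_comm. apply Rmult_le_compat_l.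
    { apply Rlt_le, Rinv_0_lt_compat, pow_lt, Ht. }
    apply Rinv_le_contravar; [apply pow_lt; lra|]. apply Rle_pow; [lra|lia].
Qed.

Lemma eisenstein_inversion (j : nat) (s : R) :
  inv_cpow_symmetric (4 + j) s -> s * s = 1 ->
  exists kappa, forall t, 0 < t ->
    exp_series (sigma_coef (3 + j)) 0 (/ t) + kappa =
    s * t ^ (4 + j) * (exp_series (sigma_coef (3 + j)) 0 t + kappa).
Proof.
  (* [kappa] is the missing row [m = 0] with weight one half, as [(i k)^(-w) = s k^(-w)]. Inversion
     exchanges it with the column [k = 0]. *)
  intros Hs H1. exists (s * (eisenstein_factor (S (S j)) * zeta_sum (4 + j) / 2)).
  intros t Ht. assert (Hi : 0 < / t) by (apply Rinv_0_lt_compat, Ht).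
  change (3 + j)%nat with (S (S (S j))) in *.
  destruct (sigma_exp_series_lattice (S (S j)) t Ht) as [_ E1].
  destruct (sigma_exp_series_lattice (S (S j)) (/ t) Hi) as [_ E2].
  rewrite E1, E2. change (S (S (S (S j)))) with (4 + j)%nat.
  rewrite (inv_cpow_double_sum_inversion _ s t Hs Ht), (inv_cpow_double_sum_swap j t Ht).
  rewrite pow_inv.
  set (P := t ^ (4 + j)). assert (HP : 0 < P) by (apply pow_lt, Ht).
  set (G := eisenstein_factor _). set (Z := zeta_sum _). set (D := inv_cpow_double_sum _ _).
  transitivity (G * Z * P / 2 + G * s * P * D + s * G * Z / 2); [field; lra|].
  transitivity (s * s * (G * Z * P / 2) + G * s * P * D + s * G * Z / 2);
    [rewrite H1; ring|field; lra].
Qed.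

(** * Weight two: conditional convergence *)

Lemma is_series_telescope (v : nat -> R) (l : R) :
  is_lim_seq v l -> is_series (fun k => v (S k) - v k) (l - v O).
Proof.
  intros H.
  assert (T : forall n, sum_n (fun k => v (S k) - v k) n = v (S n) - v O :> R).
  { induction n as [|n IH]; [apply sum_n_0|]. rewrite sum_n_succ, IH. ring. }
  assert (L : is_lim_seq (fun n => v (S n) - v O) (l - v O)).
  { apply is_lim_seq_minus'; [|apply is_lim_seq_const].
    now apply (is_lim_seq_incr_1 v). }
  apply (is_lim_seq_ext _ (sum_n (fun k => v (S k) - v k))) in L; [exact L|].
  intros n. symmetry. apply T.
Qed.

Lemma is_lim_seq_half_integers : is_lim_seq (fun k => INR k + / 2) p_infty.
Proof.
  apply (is_lim_seq_plus INR (fun _ => / 2) p_infty (/ 2)).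
  - apply is_lim_seq_INR.
  - apply is_lim_seq_const.
  - reflexivity.
Qed.

Section WeightTwo.

Variable t : R.
Hypothesis Ht : 0 < t.

(** An antiderivative in [y] of the term [a], extended to real [k + 1]; hence [c m k] is the
    integral of that term over the unit interval centred at [k + 1]. *)
Let u (m : nat) (y : R) : R := y / (INR (S m) ^ 2 + t ^ 2 * y ^ 2).
Let a (m k : nat) : R :=
  (INR (S m) ^ 2 - t ^ 2 * INR (S k) ^ 2) / (INR (S m) ^ 2 + t ^ 2 * INR (S k) ^ 2) ^ 2.
Let c (m k : nat) : R := u m (INR (S k) + / 2) - u m (INR k + / 2).

(** The error of the midpoint rule. It gains a factor [t^2 / D] in size over the terms, and
    [D^2 >= 4 t^2 M^2 K^2] turns this into a product majorant. *)
Let a_sub_c_bound m k :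
  Rabs (a m k - c m k) <= 5 / 4 * / INR (S m) ^ 2 * / INR (S k) ^ 2.
Proof.
  unfold a, c, u. pose proof (INR_S_ge_1 m) as Hm. pose proof (INR_S_ge_1 k) as Hk.
  replace (INR k + / 2) with (INR (S k) - / 2) by (rewrite (S_INR k); field).
  set (M := INR (S m)) in *. set (K := INR (S k)) in *.
  assert (T2 : 0 < t ^ 2) by (apply pow_lt, Ht).
  assert (M2 : 1 <= M ^ 2) by nra. assert (K2 : 1 <= K ^ 2) by nra.
  set (D := M ^ 2 + t ^ 2 * K ^ 2).
  set (Dp := M ^ 2 + t ^ 2 * (K + / 2) ^ 2). set (Dm := M ^ 2 + t ^ 2 * (K - / 2) ^ 2).
  assert (TK : t ^ 2 <= t ^ 2 * K ^ 2) by nra.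
  assert (HD : 0 < D) by (unfold D; lra).
  assert (HDp : D <= Dp) by (unfold D, Dp; nra).
  assert (HDm : D / 4 <= Dm).
  { unfold D, Dm. assert (K ^ 2 / 4 <= (K - / 2) ^ 2) by nra. nra. }
  (* [Q] is the numerator after cancellation, [(M^2 - t^2 K^2) (Dp Dm - D^2) - t^2 D^2 / 4];
     identities [F] and [G] below produce it. *)
  set (Q := (M ^ 2 - t ^ 2 * K ^ 2) * (t ^ 2 * D / 2 + t ^ 2 * t ^ 2 / 16 - t ^ 2 * (t ^ 2 * K ^ 2))
    - t ^ 2 * D ^ 2 / 4).
  assert (E : (M ^ 2 - t ^ 2 * K ^ 2) / D ^ 2 - ((K + / 2) / Dp - (K - / 2) / Dm)
    = Q / (D ^ 2 * (Dp * Dm))).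
  { assert (F : (K + / 2) * Dm - (K - / 2) * Dp = M ^ 2 - t ^ 2 * K ^ 2 + t ^ 2 / 4).
    { unfold Dp, Dm. field. }
    assert (G : Dp * Dm = (D + t ^ 2 / 4) ^ 2 - t ^ 2 * (t ^ 2 * K ^ 2)).
    { unfold Dp, Dm, D. field. }
    transitivity (((M ^ 2 - t ^ 2 * K ^ 2) * (Dp * Dm) - ((K + / 2) * Dm - (K - / 2) * Dp) * D ^ 2)
      / (D ^ 2 * (Dp * Dm))).
    - field. repeat split; lra.
    - rewrite F. unfold Rdiv. f_equal. rewrite G. unfold Q. field. }
  rewrite E.
  assert (HQ : Rabs Q <= 5 / 4 * t ^ 2 * D ^ 2).
  { assert (X : Rabs (M ^ 2 - t ^ 2 * K ^ 2) <= D) by (apply Rabs_le; unfold D; lra).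
    assert (Y : Rabs (t ^ 2 * D / 2 + t ^ 2 * t ^ 2 / 16 - t ^ 2 * (t ^ 2 * K ^ 2)) <= t ^ 2 * D).
    { apply Rabs_le. unfold D. split; nra. }
    unfold Q. eapply Rle_trans; [apply Rabs_triang|].
    rewrite Rabs_Ropp, Rabs_mult, (Rabs_pos_eq (t ^ 2 * D ^ 2 / 4)) by nra.
    assert (Rabs (M ^ 2 - t ^ 2 * K ^ 2) *
      Rabs (t ^ 2 * D / 2 + t ^ 2 * t ^ 2 / 16 - t ^ 2 * (t ^ 2 * K ^ 2)) <= D * (t ^ 2 * D)).
    { apply Rmult_le_compat; auto; apply Rabs_pos. }
    nra. }
  assert (D2 : 0 < D ^ 2) by (apply pow_lt, HD).
  assert (HDD : D ^ 2 / 4 <= Dp * Dm).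
  { replace (D ^ 2 / 4) with (D * (D / 4)) by field. apply Rmult_le_compat; lra. }
  assert (MTK : 4 * t ^ 2 * (M ^ 2 * K ^ 2) <= D ^ 2).
  { unfold D. pose proof (pow2_ge_0 (M ^ 2 - t ^ 2 * K ^ 2)). nra. }
  unfold Rdiv at 1. rewrite Rabs_mult, (Rabs_pos_eq (/ _)).
  2:{ apply Rlt_le, Rinv_0_lt_compat, Rmult_lt_0_compat; lra. }
  apply (Rle_trans _ (5 / 4 * t ^ 2 * D ^ 2 * / (D ^ 2 * (Dp * Dm)))).
  { apply Rmult_le_compat_r; [|exact HQ].
    apply Rlt_le, Rinv_0_lt_compat, Rmult_lt_0_compat; lra. }
  replace (5 / 4 * t ^ 2 * D ^ 2 * / (D ^ 2 * (Dp * Dm))) with (5 / 4 * t ^ 2 * / (Dp * Dm)).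
  2:{ field. repeat split; lra. }
  replace (5 / 4 * / M ^ 2 * / K ^ 2) with (5 / 4 * t ^ 2 * / (t ^ 2 * (M ^ 2 * K ^ 2)))
    by (field; repeat split; lra).
  apply Rmult_le_compat_l; [lra|]. apply Rinv_le_contravar; [|lra].
  repeat apply Rmult_lt_0_compat; lra.
Qed.

Let V (y : R) : R := Series (fun m => u m y).

Let u_eq m y : 0 < y -> u m y = / t * ((t * y) / ((t * y) ^ 2 + INR (S m) ^ 2)).
Proof.
  intros Hy. unfold u. pose proof (INR_S_ge_1 m).
  assert (0 < (t * y) ^ 2) by (apply pow_lt, Rmult_lt_0_compat; lra).
  assert (0 < INR (S m) ^ 2) by (apply pow_lt; lra).
  field. repeat split; nra.
Qed.

Let ex_u y : 0 < y -> ex_series (fun m => u m y).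
Proof.
  intros Hy. apply (ex_series_ext (fun m => / t * ((t * y) / ((t * y) ^ 2 + INR (S m) ^ 2)))).
  - intros m. symmetry. apply u_eq, Hy.
  - apply ex_series_scal_R, coth_partial_fractions. apply Rmult_lt_0_compat; lra.
Qed.

Let half_pos k : 0 < INR k + / 2.
Proof. pose proof (pos_INR k). lra. Qed.

Let lim_u m : is_lim_seq (fun k => u m (INR k + / 2)) 0.
Proof.
  assert (T2 : 0 < t ^ 2) by (apply pow_lt, Ht).
  apply (is_lim_seq_le_le (fun _ => 0) _ (fun k => / t ^ 2 * / (INR k + / 2))).
  - intros k. pose proof (half_pos k) as Hk. pose proof (INR_S_ge_1 m) as Hm. unfold u.
    set (y := INR k + / 2) in *.
    assert (0 < y ^ 2) by (apply pow_lt, Hk).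
    assert (0 < INR (S m) ^ 2) by (apply pow_lt; lra).
    assert (0 < t ^ 2 * y ^ 2) by (apply Rmult_lt_0_compat; lra).
    split; [apply Rlt_le, Rdiv_lt_0_compat; lra|].
    replace (/ t ^ 2 * / y) with (y / (t ^ 2 * y ^ 2)) by (field; lra).
    apply Rmult_le_compat_l; [lra|]. apply Rinv_le_contravar; lra.
  - apply is_lim_seq_const.
  - replace (Finite 0) with (Rbar_mult (/ t ^ 2) 0) by (simpl; f_equal; ring).
    apply is_lim_seq_scal_l.
    apply (is_lim_seq_inv _ p_infty); [apply is_lim_seq_half_integers|easy].
Qed.

(** By the partial fractions, [V y = (PI coth (PI t y) - / (t y)) / (2 t)]. *)
Let lim_V : is_lim_seq (fun k => V (INR k + / 2)) (PI / (2 * t)).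
Proof.
  pose proof PI_RGT_0 as HP.
  set (x := fun k => t * (INR k + / 2)).
  assert (Hx : forall k, 0 < x k) by (intros k; apply Rmult_lt_0_compat; [lra|apply half_pos]).
  assert (Lx : is_lim_seq x p_infty).
  { apply (is_lim_seq_ext (fun k => t * (INR k + / 2))); [reflexivity|].
    pose proof (is_lim_seq_scal_l _ t _ is_lim_seq_half_integers) as L.
    replace (Rbar_mult t p_infty) with p_infty in L; [exact L|].
    simpl. destruct (Rle_dec 0 t) as [H|H]; [|lra].
    destruct (Rle_lt_or_eq_dec 0 t H); [reflexivity|lra]. }
  assert (Li : is_lim_seq (fun k => / x k) 0).
  { apply (is_lim_seq_inv _ p_infty); [exact Lx|easy]. }
  assert (Le : is_lim_seq (fun k => exp (- (2 * PI * x k))) 0).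
  { apply (is_lim_seq_le_le (fun _ => 0) _ (fun k => / (2 * PI) * / x k)).
    - intros k. split; [apply Rlt_le, exp_pos|]. specialize (Hx k).
      rewrite exp_Ropp, <- Rinv_mult. apply Rinv_le_contravar; [nra|].
      pose proof (one_add_le_exp (2 * PI * x k)). lra.
    - apply is_lim_seq_const.
    - replace (Finite 0) with (Rbar_mult (/ (2 * PI)) 0) by (simpl; f_equal; ring).
      apply is_lim_seq_scal_l, Li. }
  apply (is_lim_seq_ext (fun k => / (2 * t) *
    (PI * (1 + exp (- (2 * PI * x k))) / (1 - exp (- (2 * PI * x k))) - / x k))).
  - intros k. destruct (coth_partial_fractions (x k) (Hx k)) as [_ E].
    rewrite <- E. unfold V. rewrite (Series_ext _ _ (fun m => u_eq m _ (half_pos k))).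
    rewrite Series_scal_l. fold (x k). field. specialize (Hx k). lra.
  - replace (Finite (PI / (2 * t))) with
      (Finite (/ (2 * t) * (PI * (1 + 0) / (1 - 0) - 0))) by (f_equal; field; lra).
    apply (is_lim_seq_scal_l _ (/ (2 * t))
      (Finite (PI * (1 + 0) / (1 - 0) - 0))).
    apply is_lim_seq_minus'; [|exact Li].
    apply is_lim_seq_div'; [| |lra].
    + apply is_lim_seq_mult'; [apply is_lim_seq_const|].
      apply is_lim_seq_plus'; [apply is_lim_seq_const|exact Le].
    + apply is_lim_seq_minus'; [apply is_lim_seq_const|exact Le].
Qed.

(* The order of summation matters here. The double series becomes absolutely
   convergent after subtracting the midpoint differences [c] of an
   antiderivative, and the two iterated sums of [c] can be computed. *)
Lemma inv_cpow_double_sum_2_anomaly :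
  inv_cpow_double_sum 2 t -
  Series (fun m => Series (fun k => fst (inv_cpow (INR (S k) * t) (INR (S m)) 2)))
  = - (PI / (2 * t)).
Proof.
  set (A := fun m => 5 / 4 * / INR (S m) ^ 2).
  set (B := fun k => / INR (S k) ^ 2).
  assert (HA : ex_series A) by apply ex_series_scal_R, ex_series_inv_sq.
  assert (HB : ex_series B) by apply ex_series_inv_sq.
  set (e := fun m k => a m k - c m k).
  assert (He : forall m k, Rabs (e m k) <= A m * B k) by exact a_sub_c_bound.
  (* Summing [c] over [k] first telescopes to [- u m (/ 2)], as [u m] tends to 0. Summing over [m]
     first telescopes in [V], whose limit is [PI / (2 t)]: this is the whole discrepancy. *)
  assert (Hc : forall m, is_series (c m) (- u m (/ 2))).
  { intros m. pose proof (is_series_telescope _ _ (lim_u m)) as H.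
    cbv beta in H. change (INR 0) with 0 in H. rewrite Rplus_0_l, Rminus_0_l in H. exact H. }
  assert (Hc' : forall k, ex_series (fun m => c m k) /\
    Series (fun m => c m k) = V (INR (S k) + / 2) - V (INR k + / 2)).
  { intros k. split.
    - apply (ex_series_minus (V := R_NormedModule)
        (fun m => u m (INR (S k) + / 2)) (fun m => u m (INR k + / 2))); apply ex_u, half_pos.
    - apply Series_minus; apply ex_u, half_pos. }
  assert (HV : is_series (fun k => V (INR (S k) + / 2) - V (INR k + / 2))
    (PI / (2 * t) - V (/ 2))).
  { pose proof (is_series_telescope _ _ lim_V) as H.
    cbv beta in H. change (INR 0) with 0 in H. rewrite Rplus_0_l in H. exact H. }
  assert (R1 : forall m, Series (a m) = Series (e m) + - u m (/ 2)).
  { intros m. rewrite <- (is_series_unique _ _ (Hc m)), <- Series_plus.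
    - apply Series_ext. intros k. unfold e. ring.
    - exact (ex_series_row e A B HB He m).
    - eexists; apply Hc. }
  assert (R2 : forall k, Series (fun m => a m k) =
    Series (fun m => e m k) + (V (INR (S k) + / 2) - V (INR k + / 2))).
  { intros k. destruct (Hc' k) as [E1 E2]. rewrite <- E2, <- Series_plus.
    - apply Series_ext. intros m. unfold e. ring.
    - exact (ex_series_col e A B HA He k).
    - exact E1. }
  assert (S1 : Series (fun m => Series (a m)) = Series (fun m => Series (e m)) - V (/ 2)).
  { rewrite (Series_ext _ _ R1), Series_plus.
    - rewrite Series_opp. reflexivity.
    - exact (ex_series_Series_row e A B HA HB He).
    - apply (ex_series_opp (V := R_NormedModule) (fun m => u m (/ 2))), ex_u. lra. }
  assert (S2 : Series (fun k => Series (fun m => a m k)) =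
    Series (fun m => Series (e m)) + (PI / (2 * t) - V (/ 2))).
  { rewrite (Series_ext _ _ R2), Series_plus.
    - rewrite (is_series_unique _ _ HV). f_equal. symmetry.
      exact (Series_swap e A B HA HB He).
    - apply (ex_series_Series_row (fun k m => e m k) B A HB HA).
      intros k m. rewrite Rmult_comm. apply He.
    - eexists; exact HV. }
  assert (P : forall m k, fst (inv_cpow (INR (S k) * t) (INR (S m)) 2) = - a m k).
  { intros m k. pose proof (INR_S_ge_1 m). pose proof (INR_S_ge_1 k).
    assert (0 < INR (S m) ^ 2) by (apply pow_lt; lra).
    assert (0 < t ^ 2 * INR (S k) ^ 2)
      by (apply Rmult_lt_0_compat; apply pow_lt; lra).
    rewrite inv_cpow_2 by (rewrite Rpow_mult_distr; lra).
    unfold a. rewrite !Rpow_mult_distr. field. lra. }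
  unfold inv_cpow_double_sum.
  rewrite (Series_ext (fun m => Series (fun k => fst (inv_cpow (INR (S m) * t) (INR (S k)) 2)))
    (fun k => - Series (fun m => a m k))).
  2:{ intros k. rewrite <- Series_opp. apply Series_ext. intros m. apply P. }
  rewrite (Series_ext (fun m => Series (fun k => fst (inv_cpow (INR (S k) * t) (INR (S m)) 2)))
    (fun m => - Series (a m))).
  2:{ intros m. rewrite <- Series_opp. apply Series_ext. intros k. apply P. }
  rewrite !Series_opp, S1, S2. ring.
Qed.

End WeightTwo.

(** The quasimodularity of the Eisenstein series of weight 2: [kappa] is again half a zeta value
    times the factor, and [mu] comes from the exchange of sums. *)
Lemma eisenstein_2_inversion :
  exists kappa mu, forall t, 0 < t ->
    exp_series (sigma_coef 1) 0 (/ t) + t ^ 2 * exp_series (sigma_coef 1) 0 t =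
    kappa * (1 + t ^ 2) + mu * t.
Proof.
  exists (eisenstein_factor 0 * zeta_sum 2 / 2), (- (eisenstein_factor 0 * PI / 2)).
  intros t Ht. assert (Hi : 0 < / t) by (apply Rinv_0_lt_compat, Ht).
  destruct (sigma_exp_series_lattice 0 t Ht) as [_ E1].
  destruct (sigma_exp_series_lattice 0 (/ t) Hi) as [_ E2].
  rewrite E1, E2, (inv_cpow_double_sum_inversion 2 (-1) t inv_cpow_symmetric_2 Ht).
  pose proof (inv_cpow_double_sum_2_anomaly t Ht) as H.
  set (D' := Series _) in *.
  replace (inv_cpow_double_sum 2 t) with (D' - PI / (2 * t)) by lra.
  field. lra.
Qed.

(** * Differential operators and hypergeometric coefficients *)

Definition hyp_coef (b : R) (N j : nat) : R :=
  pochhammer (- INR N) j / pochhammer b j / INR (fact j).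

Definition shift_coef (p : nat -> R) (j : nat) : R :=
  match j with O => 0 | S i => p i end.

Lemma pochhammer_S_l (x : R) (j : nat) : pochhammer x (S j) = x * pochhammer (x + 1) j.
Proof.
  induction j as [|j IH]; [simpl; ring|].
  change (pochhammer x (S (S j))) with (pochhammer x (S j) * (x + INR (S j))).
  rewrite IH, S_INR. simpl. ring.
Qed.

Lemma pochhammer_pos (x : R) (j : nat) : 0 < x -> 0 < pochhammer x j.
Proof.
  intros Hx. induction j as [|j IH]; simpl; [lra|].
  apply Rmult_lt_0_compat; [exact IH|]. pose proof (pos_INR j). lra.
Qed.

Lemma pochhammer_neg_nat (N j : nat) : (N < j)%nat -> pochhammer (- INR N) j = 0.
Proof.
  intros H. induction H as [|j H IH]; simpl; [ring|]. rewrite IH. ring.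
Qed.

Lemma pochhammer_neg_nat_S (N j : nat) :
  pochhammer (- INR (S N)) (S j) = - INR (S N) * pochhammer (- INR N) j.
Proof. rewrite pochhammer_S_l. do 2 f_equal. rewrite S_INR. ring. Qed.

Lemma hyp_coef_zero (b : R) (N j : nat) : (N < j)%nat -> hyp_coef b N j = 0.
Proof. intros H. unfold hyp_coef. rewrite pochhammer_neg_nat by exact H. unfold Rdiv. ring. Qed.

Lemma sum_n_extend (p : nat -> R) (N L : nat) :
  (N <= L)%nat -> (forall j, (N < j)%nat -> p j = 0) -> sum_n p L = sum_n p N :> R.
Proof.
  intros HL H. induction HL as [|L HL IH]; [reflexivity|].
  rewrite sum_n_succ, IH, H by lia. apply Rplus_0_r.
Qed.

Lemma sum_n_shift (p : nat -> R) (L : nat) :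
  sum_n (fun j => shift_coef p j) (S L) = sum_n p L :> R.
Proof.
  induction L as [|L IH].
  - rewrite sum_n_succ, !sum_n_0. simpl. ring.
  - rewrite sum_n_succ, IH, sum_n_succ. reflexivity.
Qed.

Lemma hyp1F1_neg_nat (a b z : R) (N L : nat) :
  a = - INR N -> (N <= L)%nat ->
  hyp1F1 a b z = sum_n (fun j => hyp_coef b N j * z ^ j) L.
Proof.
  intros -> HL. unfold hyp1F1.
  rewrite (Series_ext _ (fun j => hyp_coef b N j * z ^ j)).
  - apply Series_finite. intros j Hj. rewrite hyp_coef_zero by lia. ring.
  - intros j. unfold hyp_coef, Rdiv. ring.
Qed.

(* The Euler operator [t d/dt + a] acts on the coefficients of
   [sum_j p j (c t)^(N + j) exp (- c t)] in this way. *)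
Definition euler_coef (a : R) (p : nat -> R) (j : nat) : R :=
  (a + INR j) * p j - shift_coef p j.

(** The lowest term disappears, so the leading power rises from [(c t)^N] to [(c t)^(N + 1)]. *)
Lemma euler_sq_hyp_coef_0 (A b : R) (N : nat) :
  euler_coef A (euler_coef A (hyp_coef b N)) 0 - A ^ 2 * hyp_coef b N 0 = 0.
Proof. unfold euler_coef. simpl. ring. Qed.

Lemma INR_fact_S (j : nat) : INR (fact (S j)) = (INR j + 1) * INR (fact j).
Proof. now rewrite fact_simpl, mult_INR, S_INR. Qed.

(** Let [E] be the Euler operator in [x = c t] and [w = 2 a]. Conjugated by [exp (a u)], [D^2 - A^2]
    becomes [(E - N) (E + N + w)]. By Kummer's transformation the function is
    [x^N 1F1(2 N + w; N + w; - x)], on whose power series both factors act diagonally; the shift of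
    the three parameters gives the constant. *)
Lemma euler_sq_hyp_coef_S (a : R) (N j : nat) :
  0 < a ->
  let A := a + INR N in
  euler_coef A (euler_coef A (hyp_coef (INR N + 2 * a) N)) (S j)
    - A ^ 2 * hyp_coef (INR N + 2 * a) N (S j)
  = - ((2 * A + 1) * (2 * A) / (INR N + 2 * a)) * hyp_coef (INR (S N) + 2 * a) (S N) j.
Proof.
  intros Ha A. pose proof (pos_INR N) as HN.
  assert (Hb : INR (S N) + 2 * a = INR N + 2 * a + 1) by (rewrite S_INR; ring).
  rewrite Hb. unfold A. clear A. set (b := INR N + 2 * a) in *.
  assert (Hb0 : 0 < b) by (unfold b; lra).
  destruct j as [|i].
  - unfold euler_coef, hyp_coef. simpl. unfold b in *. field. lra.
  - unfold euler_coef, shift_coef, hyp_coef.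
    rewrite pochhammer_neg_nat_S, (S_INR N), !INR_fact_S, !S_INR.
    replace (pochhammer (b + 1) (S i)) with (pochhammer b i * (b + INR i) * (b + (INR i + 1)) / b).
    2:{ assert (E : b * pochhammer (b + 1) (S i) = pochhammer b (S (S i)))
          by now rewrite <- pochhammer_S_l.
        simpl pochhammer in E |- *.
        change (match i with O => 1 | S _ => INR i + 1 end) with (INR (S i)) in E.
        rewrite S_INR in E. apply (Rmult_eq_reg_l b); [|lra]. rewrite E. field. lra. }
    cbn [pochhammer]. rewrite !S_INR.
    pose proof (pochhammer_pos b i Hb0) as HP. pose proof (INR_fact_lt_0 i) as HF.
    pose proof (pos_INR i) as Hi.
    set (P := pochhammer b i) in *. set (X := pochhammer (- INR N) i).
    set (Fi := INR (fact i)) in *. set (y := INR i) in *. unfold b in *. clear b.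
    set (n := INR N) in *. field. repeat split; lra.
Qed.

(** A contiguous relation for [w = 4]: at [N = k + 1] the first derivative becomes the bracket of
    the sigma_3 identity. *)
Lemma euler_hyp_coef (N j : nat) :
  euler_coef (2 + INR N) (hyp_coef (INR N + 4) N) j =
  (INR N + 2) * (hyp_coef (INR N + 4) (S N) j
    - shift_coef (hyp_coef (INR N + 5) N) j / (INR N + 4)).
Proof.
  pose proof (pos_INR N) as HN. unfold euler_coef.
  destruct j as [|i].
  - unfold hyp_coef. simpl. field. lra.
  - unfold shift_coef, hyp_coef. rewrite pochhammer_neg_nat_S, (S_INR N).
    replace (pochhammer (INR N + 5) i) with (pochhammer (INR N + 4) (S i) / (INR N + 4)).
    2:{ rewrite pochhammer_S_l. replace (INR N + 4 + 1) with (INR N + 5) by ring. field. lra. }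
    cbn [pochhammer]. rewrite INR_fact_S, S_INR.
    pose proof (pochhammer_pos (INR N + 4) i ltac:(lra)) as HP.
    pose proof (INR_fact_lt_0 i) as HF. pose proof (pos_INR i) as Hi.
    field. repeat split; lra.
Qed.

(** The counterpart for [w = 2]: at [N = k + 1] the second derivative becomes the bracket of the
    sigma_1 identity. *)
Lemma euler_sq_hyp_coef (N j : nat) :
  euler_coef (1 + INR N) (euler_coef (1 + INR N) (hyp_coef (INR N + 2) N)) j =
  (INR N + 1) ^ 2 * (hyp_coef (INR N + 1) (S (S N)) j
    - shift_coef (hyp_coef (INR N + 2) (S N)) j / (INR N + 1)).
Proof.
  pose proof (pos_INR N) as HN. unfold euler_coef.
  destruct j as [|[|i]].
  - unfold hyp_coef. simpl. field. lra.
  - unfold shift_coef, hyp_coef. cbn [pochhammer fact]. rewrite !S_INR. simpl. field. lra.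
  - unfold shift_coef, hyp_coef. rewrite !pochhammer_neg_nat_S, !(S_INR N).
    rewrite (S_INR (S N)), (S_INR N).
    replace (pochhammer (INR N + 1) (S (S i)))
      with ((INR N + 1) * pochhammer (INR N + 2) (S i)).
    2:{ rewrite (pochhammer_S_l _ (S i)). do 2 f_equal. ring. }
    cbn [pochhammer]. rewrite !INR_fact_S, !S_INR.
    pose proof (pochhammer_pos (INR N + 2) i ltac:(lra)) as HP.
    pose proof (INR_fact_lt_0 i) as HF. pose proof (pos_INR i) as Hi.
    field. repeat split; lra.
Qed.

(** * Parity in [u] and its propagation by the operators *)

Section Parity.

Variables (s : nat -> R) (p : nat) (a : R).
Hypothesis Hs : forall n, Rabs (s n) <= INR (S n) ^ p.
Hypothesis Ha : 0 < a.

(** With [t = exp u], this is [t^a] times the sum of [s n (freq n t)^j exp (- freq n t)]. *)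
Definition twisted_series (j : nat) (u : R) : R :=
  exp ((a + INR j) * u) * exp_series s j (exp u).

Lemma is_derive_twisted_series (j : nat) (u : R) :
  is_derive (twisted_series j) u
    ((a + INR j) * twisted_series j u - twisted_series (S j) u).
Proof.
  unfold twisted_series.
  pose proof (is_derive_exp_series s p j (exp u) (exp_pos u) Hs) as D.
  auto_derive; [repeat split; eexists; exact D|].
  rewrite (is_derive_unique (fun y : R => exp_series s j y : R) _ _ D).
  replace ((a + INR (S j)) * u) with ((a + INR j) * u + u) by (rewrite S_INR; ring).
  rewrite exp_plus. ring.
Qed.

Definition comb (N L : nat) (q : nat -> R) (u : R) : R :=
  sum_n (fun j => q j * twisted_series (N + j) u) L.

Lemma is_derive_comb (N L : nat) (q : nat -> R) (u : R) :
  q L = 0 ->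
  is_derive (comb N L q) u (comb N L (euler_coef (a + INR N) q) u).
Proof.
  (* Without [q L = 0] the derivative spills one term past the range; the induction on [L] has to
     carry it. *)
  assert (G : is_derive (comb N L q) u
    (comb N L (euler_coef (a + INR N) q) u - q L * twisted_series (N + S L) u)).
  { unfold comb. induction L as [|L IH].
    - apply (is_derive_ext (fun u => q O * twisted_series (N + 0) u)).
      { intros v. symmetry. apply sum_n_0. }
      rewrite sum_n_0. unfold euler_coef. simpl shift_coef.
      pose proof (is_derive_twisted_series (N + 0) u) as D.
      auto_derive; [eexists; exact D|].
      rewrite (is_derive_unique (fun y : R => twisted_series (N + 0) y : R) _ _ D).
      rewrite <- Nat.add_succ_r, plus_INR. ring.
    - apply (is_derive_ext (fun u => sum_n (fun j => q j * twisted_series (N + j) u) L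
        + q (S L) * twisted_series (N + S L) u)).
      { intros v. symmetry. apply sum_n_succ. }
      rewrite sum_n_succ. unfold euler_coef at 2. simpl shift_coef.
      pose proof (is_derive_twisted_series (N + S L) u) as D.
      set (f := fun u => sum_n (fun j => q j * twisted_series (N + j) u) L : R) in *.
      change (is_derive (fun u => f u + q (S L) * twisted_series (N + S L) u) u
        (sum_n (fun j => euler_coef (a + INR N) q j * twisted_series (N + j) u) L +
         ((a + INR N + INR (S L)) * q (S L) - q L) * twisted_series (N + S L) u -
         q (S L) * twisted_series (N + S (S L)) u)).
      set (v := sum_n _ L) in *.
      auto_derive; [repeat split; eexists; [exact IH|exact D]|].
      rewrite (is_derive_unique (fun y : R => twisted_series (N + S L) y : R) _ _ D).
      rewrite (is_derive_unique (fun y : R => f y : R) _ _ IH).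
      rewrite <- Nat.add_succ_r, plus_INR. unfold v. ring. }
  intros H. rewrite H, Rmult_0_l, Rminus_0_r in G. exact G.
Qed.

(** Parity up to a constant [mu], which is needed for weight 2. *)
Definition reflects (sg mu : R) (f : R -> R) : Prop := forall u, f (- u) = sg * f u + mu.

Lemma reflects_derive (sg mu : R) (f f' : R -> R) :
  reflects sg mu f -> (forall u, is_derive f u (f' u)) -> reflects (- sg) 0 f'.
Proof.
  intros Hf D u.
  assert (D1 : is_derive (fun v => f (- v)) u (- f' (- u))).
  { pose proof (D (- u)) as Du. auto_derive; [eexists; exact Du|].
    rewrite (is_derive_unique (fun y : R => f y : R) _ _ Du). ring. }
  assert (D2 : is_derive (fun v => f (- v)) u (sg * f' u)).
  { apply (is_derive_ext (fun v => sg * f v + mu)); [intros v; symmetry; apply Hf|].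
    pose proof (D u) as Du. auto_derive; [eexists; exact Du|].
    rewrite (is_derive_unique (fun y : R => f y : R) _ _ Du). ring. }
  apply is_derive_unique in D1. apply is_derive_unique in D2. rewrite D1 in D2. lra.
Qed.

(** The polynomial has degree [N]; the two further slots make room for two derivatives. *)
Definition hyp_comb (N : nat) : R -> R := comb N (S (S N)) (hyp_coef (INR N + 2 * a) N).

Lemma is_derive_hyp_comb (N : nat) (u : R) :
  is_derive (hyp_comb N) u
    (comb N (S (S N)) (euler_coef (a + INR N) (hyp_coef (INR N + 2 * a) N)) u).
Proof. apply is_derive_comb, hyp_coef_zero. lia. Qed.

Lemma is_derive_2_hyp_comb (N : nat) (u : R) :
  is_derive (comb N (S (S N)) (euler_coef (a + INR N) (hyp_coef (INR N + 2 * a) N))) u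
    (comb N (S (S N)) (euler_coef (a + INR N)
      (euler_coef (a + INR N) (hyp_coef (INR N + 2 * a) N))) u).
Proof.
  apply is_derive_comb. unfold euler_coef, shift_coef. rewrite !hyp_coef_zero by lia. ring.
Qed.

Lemma hyp_comb_S (N : nat) (u : R) :
  comb N (S (S N)) (euler_coef (a + INR N)
      (euler_coef (a + INR N) (hyp_coef (INR N + 2 * a) N))) u
    - (a + INR N) ^ 2 * hyp_comb N u
  = - ((2 * (a + INR N) + 1) * (2 * (a + INR N)) / (INR N + 2 * a)) * hyp_comb (S N) u.
Proof.
  unfold hyp_comb, comb. set (A := a + INR N). set (h := hyp_coef (INR N + 2 * a) N).
  set (C := - _).
  (* [hyp_comb (S N)] is cut to its degree [S N], so that the shift by one index ends at [S (S N)],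
     as on the left. *)
  rewrite (sum_n_extend (fun j => hyp_coef (INR (S N) + 2 * a) (S N) j * _) (S N)).
  2: lia. 2:{ intros j Hj. rewrite hyp_coef_zero by lia. ring. }
  rewrite <- (sum_n_shift _ (S N)).
  assert (G : forall L,
    sum_n (fun j => euler_coef A (euler_coef A h) j * twisted_series (N + j) u) L
      - A ^ 2 * sum_n (fun j => h j * twisted_series (N + j) u) L =
    C * sum_n (shift_coef (fun j => hyp_coef (INR (S N) + 2 * a) (S N) j
      * twisted_series (S N + j) u)) L); [|apply G].
  assert (T : forall j, euler_coef A (euler_coef A h) j * twisted_series (N + j) u
    - A ^ 2 * (h j * twisted_series (N + j) u) =
    C * shift_coef (fun j => hyp_coef (INR (S N) + 2 * a) (S N) j
      * twisted_series (S N + j) u) j).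
  { intros [|j].
    - pose proof (euler_sq_hyp_coef_0 A (INR N + 2 * a) N) as E. fold h in E.
      simpl shift_coef. rewrite Rmult_0_r.
      transitivity ((euler_coef A (euler_coef A h) 0 - A ^ 2 * h O) * twisted_series (N + 0) u);
        [ring|]. rewrite E. ring.
    - pose proof (euler_sq_hyp_coef_S a N j Ha) as E. cbv zeta in E. fold A h C in E.
      simpl shift_coef. rewrite Nat.add_succ_r.
      rewrite <- Rmult_assoc, <- Rmult_minus_distr_r, E. apply Rmult_assoc. }
  induction L as [|L IH].
  - rewrite !sum_n_0. apply T.
  - rewrite !sum_n_succ. specialize (T (S L)). lra.
Qed.

(** [D^2 - (a + N)^2] preserves parity and rescales the constant. [f] is abstract because at [N = 0]
    it is [hyp_comb 0] plus a multiple of [exp (a u)]. *)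
Lemma reflects_hyp_comb_S (sg mu : R) (N : nat) (f f' f'' : R -> R) :
  (forall u, is_derive f u (f' u)) -> (forall u, is_derive f' u (f'' u)) ->
  (forall u, f'' u - (a + INR N) ^ 2 * f u =
    - ((2 * (a + INR N) + 1) * (2 * (a + INR N)) / (INR N + 2 * a)) * hyp_comb (S N) u) ->
  reflects sg mu f ->
  exists c, reflects sg (c * mu) (hyp_comb (S N)).
Proof.
  intros D1 D2 E R0. pose proof (pos_INR N) as HN.
  pose proof (reflects_derive _ _ _ _ R0 D1) as R1.
  pose proof (reflects_derive _ _ _ _ R1 D2) as R2.
  set (C := (2 * (a + INR N) + 1) * (2 * (a + INR N)) / (INR N + 2 * a)) in *.
  assert (HC : 0 < C).
  { apply Rdiv_lt_0_compat; [apply Rmult_lt_0_compat|]; lra. }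
  exists ((a + INR N) ^ 2 / C). intros u.
  apply (Rmult_eq_reg_l (- C)); [|lra]. rewrite <- E, R0, R2.
  replace (- C * (sg * hyp_comb (S N) u + (a + INR N) ^ 2 / C * mu))
    with (sg * (- C * hyp_comb (S N) u) - (a + INR N) ^ 2 * mu) by (field; lra).
  rewrite <- E. ring.
Qed.

Lemma reflects_hyp_comb (sg mu kappa : R) (N : nat) :
  reflects sg mu (fun u => exp (a * u) * (exp_series s 0 (exp u) + kappa)) ->
  exists c, reflects sg (c * mu) (hyp_comb (S N)).
Proof.
  intros H0. induction N as [|N [c IH]].
  - set (h1 := comb 0 2 (euler_coef (a + INR 0) (hyp_coef (INR 0 + 2 * a) 0))).
    set (h2 := comb 0 2 (euler_coef (a + INR 0)
      (euler_coef (a + INR 0) (hyp_coef (INR 0 + 2 * a) 0)))).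
    (* The constant term of the Eisenstein series enters only here: [D^2 - a^2] kills
       [kappa * exp (a * u)]. *)
    apply (reflects_hyp_comb_S sg mu 0 (fun u => hyp_comb 0 u + kappa * exp (a * u))
      (fun u => h1 u + kappa * (a * exp (a * u)))
      (fun u => h2 u + kappa * (a * (a * exp (a * u))))).
    + intros u. apply (is_derive_plus (V := R_NormedModule) (hyp_comb 0)).
      * apply is_derive_hyp_comb.
      * auto_derive; trivial. ring.
    + intros u. apply (is_derive_plus (V := R_NormedModule) h1).
      * apply is_derive_2_hyp_comb.
      * auto_derive; trivial. ring.
    + intros u. rewrite <- hyp_comb_S. fold h2. simpl (INR 0). ring.
    + assert (Z : forall u, hyp_comb 0 u = exp (a * u) * exp_series s 0 (exp u)).
      { intros u. unfold hyp_comb, comb. rewrite (sum_n_extend _ 0), sum_n_0.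
        - unfold hyp_coef, twisted_series. simpl. rewrite Rplus_0_r. field.
        - lia.
        - intros j Hj. rewrite hyp_coef_zero by exact Hj. ring. }
      intros u. rewrite !Z. specialize (H0 u). simpl in H0. lra.
  - destruct (reflects_hyp_comb_S sg (c * mu) (S N) _ _ _ (is_derive_hyp_comb (S N))
      (is_derive_2_hyp_comb (S N)) (hyp_comb_S (S N)) IH) as [c' H].
    exists (c' * c). rewrite Rmult_assoc. exact H.
Qed.

Lemma is_series_comb (N L : nat) (q : nat -> R) :
  is_series (fun n => s n * sum_n (fun j => q j * freq n ^ (N + j)) L * exp (- freq n))
    (comb N L q 0).
Proof.
  assert (T : forall j, is_series (fun n => q j * (s n * freq n ^ (N + j) * exp (- freq n)))
    (q j * twisted_series (N + j) 0)).
  { intros j. apply (is_series_scal (V := R_NormedModule) (q j)).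
    unfold twisted_series. rewrite Rmult_0_r, exp_0, Rmult_1_l. unfold exp_series.
    rewrite (Series_ext _ (fun n => s n * freq n ^ (N + j) * exp (- freq n)))
      by (intros; now rewrite Rmult_1_r).
    apply Series_correct.
    apply (ex_series_ext (fun n => s n * freq n ^ (N + j) * exp (- (freq n * 1))));
      [intros; now rewrite Rmult_1_r|].
    apply (ex_exp_series s p (N + j) 1); [lra|exact Hs]. }
  unfold comb. induction L as [|L IH].
  - rewrite sum_n_0.
    apply (is_series_ext (fun n => q O * (s n * freq n ^ (N + 0) * exp (- freq n))));
      [|apply T]. intros n. rewrite sum_n_0. refine (_ : @eq R _ _). ring.
  - rewrite sum_n_succ.
    apply (is_series_ext (fun n => plus
      (s n * sum_n (fun j => q j * freq n ^ (N + j)) L * exp (- freq n))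
      (q (S L) * (s n * freq n ^ (N + S L) * exp (- freq n))))).
    + intros n. rewrite sum_n_succ. refine (_ : @eq R _ _). unfold plus; simpl. ring.
    + apply (is_series_plus (V := R_NormedModule)); [exact IH|apply T].
Qed.

End Parity.

(** * The divisor function as a sum over a range *)

Module DivisorSum.
Import all_boot.

Lemma divisor_sigma_succ (a n : nat) :
  divisor_sigma a n.+1 = (\sum_(d < n.+1) (if d.+1 %| n.+1 then expn d.+1 a else 0))%N.
Proof.
  rewrite /divisor_sigma -[RHS](big_mkord xpredT
    (fun d => if d.+1 %| n.+1 then expn d.+1 a else 0)%N).
  rewrite -[RHS](big_add1 _ _ 0 n.+2 xpredT (fun d => if d %| n.+1 then expn d a else 0)%N).
  rewrite -[RHS]big_mkcond -[RHS]big_filter; apply: perm_big; apply: uniq_perm.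
  - exact: divisors_uniq.
  - by apply: filter_uniq; apply: iota_uniq.
  - move=> d; rewrite mem_filter -dvdn_divisors // mem_index_iota.
    case: (boolP (d %| n.+1)%N) => //= H.
    by rewrite (dvdn_gt0 _ H) // ltnS dvdn_leq.
Qed.

Lemma INR_sum (F : nat -> nat) (n : nat) :
  INR (\sum_(d < n.+1) F d)%N = sum_n (fun d => INR (F d)) n :> R.
Proof.
  elim: n => [|n IH]; first by rewrite big_ord1 sum_n_0.
  by rewrite big_ord_recr sum_n_succ plus_INR /= IH.
Qed.

Lemma INR_expn (d a : nat) : INR (expn d a) = (INR d ^ a)%R.
Proof. by elim: a => [|a IH] //; rewrite expnS mult_INR IH. Qed.

Lemma dvdn_eqb (d m : nat) : (d.+1 %| m)%N = (Nat.modulo m d.+1 =? 0)%nat.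
Proof.
  apply/idP/idP => [/dvdnP [c ->]|].
  - by apply/Nat.eqb_eq; exact: Nat.Div0.mod_mul.
  - move/Nat.eqb_eq/Nat.Div0.div_exact => ->. exact: dvdn_mulr (dvdnn _).
Qed.

Lemma INR_divisor_sigma (a n : nat) : INR (divisor_sigma a n.+1) = sigma_coef a n.
Proof.
  rewrite divisor_sigma_succ (INR_sum (fun d => if d.+1 %| n.+1 then expn d.+1 a else 0)%N).
  apply: sum_n_ext => d.
  by rewrite dvdn_eqb; case: ifP => // _; rewrite INR_expn.
Qed.

End DivisorSum.

Lemma sigma_coef_bound (a n : nat) : Rabs (sigma_coef a n) <= INR (S n) ^ S a.
Proof.
  unfold sigma_coef. eapply Rle_trans; [apply Rabs_sum_n_le|].
  apply (Rle_trans _ (sum_n (fun _ => INR (S n) ^ a) n)).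
  - rewrite !sum_n_Reals. apply sum_Rle. intros d Hd.
    destruct (S n mod S d =? 0)%nat.
    + rewrite Rabs_pos_eq by apply pow_le, pos_INR.
      apply pow_incr. split; [apply pos_INR|apply le_INR; lia].
    + rewrite Rabs_R0. apply pow_le, pos_INR.
  - rewrite sum_n_const. simpl pow. apply Rle_refl.
Qed.

(** * The three identities, read off at [t = 1] *)

Lemma reflects_of_inversion (f : R -> R) (h : nat) (sg kappa : R) :
  (forall t, 0 < t -> f (/ t) + kappa = sg * t ^ (h + h) * (f t + kappa)) ->
  reflects sg 0 (fun u => exp (INR h * u) * (f (exp u) + kappa)).
Proof.
  intros H u. rewrite <- !pow_exp, exp_Ropp, H by apply exp_pos.
  pose proof (exp_pos u) as Hu. rewrite pow_add, pow_inv.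
  assert (0 < exp u ^ h) by (apply pow_lt, Hu). field. lra.
Qed.

Lemma hyp_sum_factor (z : R) (q : nat -> R) (N L : nat) :
  sum_n (fun j => q j * z ^ (N + j)) L = z ^ N * sum_n (fun j => q j * z ^ j) L :> R.
Proof.
  rewrite <- (sum_n_mult_l (K := R_Ring)). apply sum_n_ext. intros j.
  unfold mult; simpl. rewrite pow_add. ring.
Qed.

Lemma sum_n_shift_pow (q : nat -> R) (z : R) (L : nat) :
  sum_n (fun j => shift_coef q j * z ^ j) (S L) = z * sum_n (fun j => q j * z ^ j) L :> R.
Proof.
  induction L as [|L IH].
  - rewrite sum_n_succ, !sum_n_0. simpl. ring.
  - rewrite sum_n_succ, IH, sum_n_succ. simpl. ring.
Qed.

Lemma sum_n_sub_shift (q r p : nat -> R) (c b z : R) (L : nat) :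
  c <> 0 ->
  (forall j, p j = c * (q j - shift_coef r j / b)) ->
  sum_n (fun j => q j * z ^ j) (S L) - z * sum_n (fun j => r j * z ^ j) L / b =
  / c * sum_n (fun j => p j * z ^ j) (S L).
Proof.
  intros Hc H. rewrite <- (sum_n_shift_pow r z L). generalize (S L). intros M.
  induction M as [|M IH].
  - rewrite !sum_n_0, H. unfold Rdiv.
    rewrite <- Rmult_assoc, <- (Rmult_assoc (/ c)), Rinv_l by exact Hc. ring.
  - rewrite !sum_n_succ, H, Rmult_plus_distr_l, <- IH.
    rewrite <- (Rmult_assoc (/ c)), <- (Rmult_assoc (/ c)), Rinv_l by exact Hc. unfold Rdiv. ring.
Qed.

Lemma hyp1F1_difference (a a' b b' c d z : R) (N N' L : nat) (p : nat -> R) :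
  a = - INR N -> a' = - INR N' -> (N <= S L)%nat -> (N' <= L)%nat -> c <> 0 ->
  (forall j, p j = c * (hyp_coef b N j - shift_coef (hyp_coef b' N') j / d)) ->
  hyp1F1 a b z - z * hyp1F1 a' b' z / d = / c * sum_n (fun j => p j * z ^ j) (S L).
Proof.
  intros Ea Ea' HN HN' Hc Hp.
  rewrite (hyp1F1_neg_nat a b z N (S L) Ea HN), (hyp1F1_neg_nat a' b' z N' L Ea' HN').
  apply sum_n_sub_shift; assumption.
Qed.

Lemma is_series_sigma_comb (e : nat) (a c : R) (N L : nat) (q : nat -> R) (f : nat -> R) :
  comb (sigma_coef e) a N L q 0 = 0 ->
  (forall n, f (S n) = c * (INR (divisor_sigma e (S n)) *
    (freq n ^ N * sum_n (fun j => q j * freq n ^ j) L) * exp (- freq n))) ->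
  is_series_from1 f 0.
Proof.
  intros H0 Hf. unfold is_series_from1.
  pose proof (is_series_comb (sigma_coef e) (S e) a (sigma_coef_bound e) N L q) as H.
  rewrite H0 in H. apply (is_series_scal (V := R_NormedModule) c) in H.
  rewrite <- (Rmult_0_r c).
  apply (is_series_ext (fun n => c * (sigma_coef e n *
    sum_n (fun j => q j * freq n ^ (N + j)) L * exp (- freq n)))); [|exact H].
  intros n. refine (_ : @eq R _ _). rewrite Hf, DivisorSum.INR_divisor_sigma, hyp_sum_factor. reflexivity.
Qed.

Lemma sigma_5_series (k : nat) :
  is_series_from1 (fun n : nat =>
    INR (divisor_sigma 5 n) * (2 * PI * INR n) ^ (k + 1) *
    hyp1F1 (- INR k - 1) (INR k + 7) (2 * PI * INR n) *
    exp (- (2 * PI * INR n))) 0.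
Proof.
  destruct (eisenstein_inversion 2 (-1) inv_cpow_symmetric_6) as [kappa H]; [ring|].
  apply (reflects_of_inversion _ 3) in H.
  destruct (reflects_hyp_comb (sigma_coef 5) 6 3 (sigma_coef_bound 5) ltac:(lra)
    (-1) 0 kappa k) as [c R0].
  { simpl INR in H. replace (1 + 1 + 1) with 3 in H by ring. exact H. }
  specialize (R0 0). rewrite Ropp_0 in R0.
  apply (is_series_sigma_comb 5 3 1 (S k) (S (S (S k))) (hyp_coef (INR (S k) + 2 * 3) (S k))).
  (* [R0] says that the value at 0 is its own opposite. *)
  - unfold hyp_comb in R0. set (X := comb _ _ _ _ _ _) in *. lra.
  - intros n. fold (freq n). rewrite Nat.add_1_r.
    rewrite (hyp1F1_neg_nat _ _ _ (S k) (S (S (S k)))); [|rewrite S_INR; ring|lia].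
    replace (INR (S k) + 2 * 3) with (INR k + 7) by (rewrite S_INR; ring). ring.
Qed.

Lemma sigma_3_series (k : nat) :
  is_series_from1 (fun n : nat =>
    INR (divisor_sigma 3 n) *
    ((2 * PI * INR n) ^ (k + 1) *
       hyp1F1 (- INR k - 2) (INR k + 5) (2 * PI * INR n)
     - (2 * PI * INR n) ^ (k + 2) *
       hyp1F1 (- INR k - 1) (INR k + 6) (2 * PI * INR n) / (INR k + 5)) *
    exp (- (2 * PI * INR n))) 0.
Proof.
  destruct (eisenstein_inversion 0 1 inv_cpow_symmetric_4) as [kappa H]; [ring|].
  apply (reflects_of_inversion _ 2) in H.
  destruct (reflects_hyp_comb (sigma_coef 3) 4 2 (sigma_coef_bound 3) ltac:(lra)
    1 0 kappa k) as [c R0].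
  { simpl INR in H. exact H. }
  pose proof (reflects_derive _ _ _ _ R0
    (is_derive_hyp_comb (sigma_coef 3) 4 2 (sigma_coef_bound 3) (S k))) as R1.
  specialize (R1 0). rewrite Ropp_0 in R1.
  apply (is_series_sigma_comb 3 2 (/ (INR (S k) + 2)) (S k) (S (S (S k)))
    (euler_coef (2 + INR (S k)) (hyp_coef (INR (S k) + 2 * 2) (S k)))).
  - lra.
  - intros n. fold (freq n). pose proof (pos_INR k) as Hk.
    pose proof (hyp1F1_difference (- INR k - 2) (- INR k - 1) (INR k + 5) (INR k + 6)
      (INR (S k) + 2) (INR k + 5) (freq n) (S (S k)) (S k) (S (S k))
      (euler_coef (2 + INR (S k)) (hyp_coef (INR (S k) + 2 * 2) (S k)))) as D.
    rewrite Nat.add_1_r, (Nat.add_comm k 2).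
    transitivity (INR (divisor_sigma 3 (S n)) * (freq n ^ S k *
      (hyp1F1 (- INR k - 2) (INR k + 5) (freq n)
       - freq n * hyp1F1 (- INR k - 1) (INR k + 6) (freq n) / (INR k + 5))) * exp (- freq n)).
    { simpl pow. unfold Rdiv. ring. }
    rewrite D; [ring|rewrite ?S_INR; ring|rewrite ?S_INR; ring|lia|lia|rewrite S_INR; lra|].
    intros j. replace (INR (S k) + 2 * 2) with (INR (S k) + 4) by ring.
    rewrite euler_hyp_coef. replace (INR (S k) + 4) with (INR k + 5) by (rewrite S_INR; ring).
    replace (INR (S k) + 5) with (INR k + 6) by (rewrite S_INR; ring). reflexivity.
Qed.

Lemma sigma_1_series (k : nat) :
  is_series_from1 (fun n : nat =>
    INR (divisor_sigma 1 n) *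
    ((2 * PI * INR n) ^ (k + 1) *
       hyp1F1 (- INR k - 3) (INR k + 2) (2 * PI * INR n)
     - (2 * PI * INR n) ^ (k + 2) *
       hyp1F1 (- INR k - 2) (INR k + 3) (2 * PI * INR n) / (INR k + 2)) *
    exp (- (2 * PI * INR n))) 0.
Proof.
  destruct eisenstein_2_inversion as [kappa [mu H]].
  destruct (reflects_hyp_comb (sigma_coef 1) 2 1 (sigma_coef_bound 1) ltac:(lra)
    (-1) mu (- kappa) k) as [c R0].
  (* The inversion formula divided by [t = exp u]: the term [mu * t] becomes the constant [mu], and
     [kappa] changes sides, hence [- kappa]. *)
  { intros u. rewrite !Rmult_1_l, exp_Ropp.
    pose proof (exp_pos u) as Hu. specialize (H (exp u) Hu).
    apply (Rmult_eq_reg_l (exp u)); [|lra].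
    rewrite <- Rmult_assoc, Rinv_r by lra. lra. }
  pose proof (reflects_derive _ _ _ _ R0
    (is_derive_hyp_comb (sigma_coef 1) 2 1 (sigma_coef_bound 1) (S k))) as R1.
  pose proof (reflects_derive _ _ _ _ R1
    (is_derive_2_hyp_comb (sigma_coef 1) 2 1 (sigma_coef_bound 1) (S k))) as R2.
  (* The first derivative has removed the constant [c * mu], and the second is odd. *)
  specialize (R2 0). rewrite Ropp_0 in R2.
  apply (is_series_sigma_comb 1 1 (/ (INR (S k) + 1) ^ 2) (S k) (S (S (S k)))
    (euler_coef (1 + INR (S k)) (euler_coef (1 + INR (S k))
      (hyp_coef (INR (S k) + 2 * 1) (S k))))).
  - lra.
  - intros n. fold (freq n). pose proof (pos_INR k) as Hk.
    pose proof (hyp1F1_difference (- INR k - 3) (- INR k - 2) (INR k + 2) (INR k + 3)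
      ((INR (S k) + 1) ^ 2) (INR k + 2) (freq n) (S (S (S k))) (S (S k)) (S (S k))
      (euler_coef (1 + INR (S k)) (euler_coef (1 + INR (S k))
        (hyp_coef (INR (S k) + 2 * 1) (S k))))) as D.
    rewrite Nat.add_1_r, (Nat.add_comm k 2).
    transitivity (INR (divisor_sigma 1 (S n)) * (freq n ^ S k *
      (hyp1F1 (- INR k - 3) (INR k + 2) (freq n)
       - freq n * hyp1F1 (- INR k - 2) (INR k + 3) (freq n) / (INR k + 2))) * exp (- freq n)).
    { simpl pow. unfold Rdiv. ring. }
    rewrite D; [ring|rewrite ?S_INR; ring|rewrite ?S_INR; ring|lia|lia| |].
    { apply pow_nonzero. rewrite S_INR. lra. }
    intros j. replace (INR (S k) + 2 * 1) with (INR (S k) + 2) by ring.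
    rewrite euler_sq_hyp_coef. replace (INR (S k) + 1) with (INR k + 2) by (rewrite S_INR; ring).
    replace (INR (S k) + 2) with (INR k + 3) by (rewrite S_INR; ring). reflexivity.
Qed.

Theorem theorem3 : forall k : nat,
  is_series_from1 (fun n : nat =>
    INR (divisor_sigma 1 n) *
    ((2 * PI * INR n) ^ (k + 1) *
       hyp1F1 (- INR k - 3) (INR k + 2) (2 * PI * INR n)
     - (2 * PI * INR n) ^ (k + 2) *
       hyp1F1 (- INR k - 2) (INR k + 3) (2 * PI * INR n) / (INR k + 2)) *
    exp (- (2 * PI * INR n))) 0
  /\
  is_series_from1 (fun n : nat =>
    INR (divisor_sigma 3 n) *
    ((2 * PI * INR n) ^ (k + 1) *
       hyp1F1 (- INR k - 2) (INR k + 5) (2 * PI * INR n)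
     - (2 * PI * INR n) ^ (k + 2) *
       hyp1F1 (- INR k - 1) (INR k + 6) (2 * PI * INR n) / (INR k + 5)) *
    exp (- (2 * PI * INR n))) 0
  /\
  is_series_from1 (fun n : nat =>
    INR (divisor_sigma 5 n) * (2 * PI * INR n) ^ (k + 1) *
    hyp1F1 (- INR k - 1) (INR k + 7) (2 * PI * INR n) *
    exp (- (2 * PI * INR n))) 0.
Proof.
  intros k. split; [apply sigma_1_series|].
  split; [apply sigma_3_series|apply sigma_5_series].
Qed.
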